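(* Let $d\in\mathbb{N}$ and let $S_N=\sum_{n=1}^N X_n$ be a random walk on $\mathbb{Z}^d$ with i.i.d. steps satisfying the non-degeneracy and aperiodicity assumptions of the context. Suppose that $\mathbb{E}(X_1)=0$ and $\mathbb{E}(|X_1|^k)<\infty$ for all $k\in\mathbb{N}$. Let $\beta\in[0,1)$, and $$\rho_d(\beta)=\begin{cases}\frac12&\text{if }\beta\le\frac{d-1}{d}\\ \frac d2(\beta-1)+1&\text{if }\beta>\frac{d-1}{d}.\end{cases}$$ If either $d=1$ and $F\in\mathbf{G}^\beta_{2/\beta}$, or $d\ge2$ and $F\in\mathbf{G}^\beta_\infty$, and $\bar F=0$, then, with $T_N=\sum_{n=1}^NF(S_n)$, with probability $1$, for all $\varepsilon>0$, $$\lim_{N\to\infty}\frac{T_N}{N^{\rho_d(\beta)+\varepsilon}}=0.$$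
   Context: $X_1,X_2,\dots$ are i.i.d. $\mathbb{Z}^d$-valued random variables, $S_0=0$, $S_N=\sum_{n=1}^N X_n$. Standing assumptions: (non-degeneracy) the smallest group supporting the range of $X_1$ is $\mathbb{Z}^d$; (aperiodicity) $\gcd\{n>0:\mathbb{P}(S_n=0)>0\}=1$. For a non-empty finite $V\subset\mathbb{Z}^d$ and a bounded $F:\mathbb{Z}^d\to\mathbb{R}$, $\bar F_V=\frac1{|V|}\sum_{v\in V}F(v)$. For real $a_j<b_j$, $V(a_1,b_1,\dots,a_d,b_d)=\{x\in\mathbb{Z}^d:x_j\in[a_j,b_j],\ j=1,\dots,d\}$. For $\gamma>0$, $\mathbf{G}^\beta_\gamma$ is the set of bounded $F:\mathbb{Z}^d\to\mathbb{R}$ for which there is a number $\bar F$ such that for all $a_1<b_1,\dots,a_d<b_d$ there is a constant $C$ such that for all $L>0$ and all $z\in\mathbb{Z}^d$ with $|z|<L^\gamma$ (and $V(a_1L,b_1L,\dots,a_dL,b_dL)\ne\emptyset$), $$\left|\bar F_{z+V(a_1L,b_1L,\dots,a_dL,b_dL)}-\bar F\right|<C L^{d(\beta-1)}.$$ Also $\mathbf{G}^\beta_\infty=\bigcap_{\gamma>0}\mathbf{G}^\beta_\gamma$. When $d=1$ and $\beta=0$, $2/\beta$ is interpreted as $\infty$. *)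

(* Defs.v *)
From HB Require Import structures.
From mathcomp Require Import all_boot all_order all_algebra finmap.
From mathcomp Require Import all_classical all_reals all_analysis.

Set Implicit Arguments.
Unset Strict Implicit.
Unset Printing Implicit Defensive.

Import Order.TTheory GRing.Theory Num.Theory.
Import numFieldNormedType.Exports.

Local Open Scope classical_set_scope.
Local Open Scope ring_scope.

(* The lattice Z^d.  It is an alias of 'rV[int]_d so that it can carry the
   discrete sigma-algebra. *)
Definition lattice (d : nat) : Type := 'rV[int]_d.

HB.instance Definition _ (d : nat) := GRing.Zmodule.on (lattice d).
HB.instance Definition _ (d : nat) := isPointed.Build (lattice d) 0.
HB.instance Definition _ (d : nat) :=
  @isMeasurable.Build default_measure_display (lattice d)
    (@discrete_measurable (lattice d))
    (@discrete_measurable0 _) (@discrete_measurableC _)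
    (@discrete_measurableU _).

Definition euclidean_norm (R : realType) (d : nat) (x : lattice d) : R :=
  Num.sqrt (\sum_(j < d) (x ord0 j)%:~R ^+ 2).

Section RandomWalk.
Context (R : realType) (d0 : measure_display) (Omega : measurableType d0).
Context (P : probability Omega R).

Definition mutually_independent (d1 : measure_display) (E : measurableType d1)
    (X : nat -> {RV P >-> E}) : Prop :=
  forall (I : {fset nat}) (A : nat -> set E), (forall i, measurable (A i)) ->
    P (\bigcap_(i in [set` I]) (X i @^-1` A i)) =
    (\prod_(i <- I) P (X i @^-1` A i))%E.

Definition identically_distributed (d1 : measure_display)
    (E : measurableType d1) (X : nat -> {RV P >-> E}) : Prop :=
  forall n A, measurable A ->
    distribution P (X n) A = distribution P (X 0%N) A.

Context (d : nat).
Implicit Type X : nat -> {RV P >-> lattice d}.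

(* Steps are numbered from 0: [X n] is the step X_(n+1), so [X 0] is X_1 and
   [walk X N] is X_1 + ... + X_N. *)
Definition walk X (N : nat) (w : Omega) : lattice d := \sum_(n < N) X n w.

Definition additive_functional X (F : lattice d -> R) (N : nat) (w : Omega) : R :=
  \sum_(1 <= n < N.+1) F (walk X n w).

Definition is_subgroup (H : set (lattice d)) : Prop :=
  H 0 /\ (forall x y, H x -> H y -> H (x - y)).

Definition step_range X : set (lattice d) :=
  [set v | (0 < P (X 0%N @^-1` [set v]))%E].

Definition nondegenerate_walk X : Prop :=
  smallest is_subgroup (step_range X) = setT.

Definition is_gcd (A : set nat) (g : nat) : Prop :=
  (forall n, A n -> (g %| n)%N) /\
  (forall m, (forall n, A n -> (m %| n)%N) -> (m %| g)%N).

Definition aperiodic_walk X : Prop :=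
  is_gcd [set n | (0 < n)%N /\ (0 < P [set w | walk X n w = 0%R])%E] 1.

Definition centered_step X : Prop :=
  forall j : 'I_d, ('E_P[fun w => ((X 0%N w ord0 j)%:~R : R)%R] = 0)%E.

Definition all_moments_finite X : Prop :=
  forall k : nat, ('E_P[fun w => (euclidean_norm R (X 0%N w) ^+ k)%R] < +oo)%E.

End RandomWalk.

Section GlobalAverages.
Context (R : realType) (d : nat).
Implicit Types (F : lattice d -> R) (V : set (lattice d)).

(* Only meant for non-empty finite [V]. *)
Definition lattice_average F V : R := (\sum_(v \in V) F v) / #|` fset_set V|%:R.

Definition lattice_box (a b : 'I_d -> R) : set (lattice d) :=
  [set x | forall j, a j <= (x ord0 j)%:~R <= b j].

Definition averages_near (beta gamma : R) F (m : R) : Prop :=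
  forall a b : 'I_d -> R, (forall j, a j < b j) ->
  exists C : R, forall (L : R) (z : lattice d),
    0 < L -> euclidean_norm R z < L `^ gamma ->
    let V := lattice_box (fun j => a j * L) (fun j => b j * L) in
    V !=set0 ->
    `|lattice_average F [set z + v | v in V] - m| < C * L `^ (d%:R * (beta - 1)).

Definition class_G (beta gamma : R) : set (lattice d -> R) :=
  [set F | (exists M : R, forall x, `|F x| <= M) /\
           exists m : R, averages_near beta gamma F m].

Definition class_G_infty (beta : R) : set (lattice d -> R) :=
  \bigcap_(gamma in [set gamma : R | 0 < gamma]) class_G beta gamma.

(* The class G^beta_(2/beta), where 2/0 is read as infinity. *)
Definition class_G_critical (beta : R) : set (lattice d -> R) :=
  if beta == 0 then class_G_infty beta else class_G beta (2 / beta).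

(* [global_average beta F m] says that [m] is the number attached to [F] by its
   membership in one of the classes [class_G beta gamma].  By
   [global_average_unique] it does not depend on the choice of [gamma]. *)
Definition global_average (beta : R) F (m : R) : Prop :=
  exists2 gamma : R, 0 < gamma & averages_near beta gamma F m.

Lemma global_average_unique (beta : R) F (m m' : R) :
  (0 < d)%N -> beta < 1 ->
  global_average beta F m -> global_average beta F m' -> m = m'.
Proof.
move=> d0 b1 [g g0 Hm] [g' g0' Hm'].
have a01 (j : 'I_d) : (0 : R) < 1 by exact: ltr01.
have [C HC] := Hm (fun=> 0) (fun=> 1) a01.
have [C' HC'] := Hm' (fun=> 0) (fun=> 1) a01.
set e := d%:R * (beta - 1) in HC HC'.
have e0 : e < 0 by rewrite pmulr_rlt0 ?ltr0n// subr_lt0.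
have norm0 : euclidean_norm R (0 : lattice d) = 0.
  rewrite /euclidean_norm big1 ?sqrtr0// => j _.
  by rewrite mxE expr0n.
have key (L : R) : 0 < L -> `|m - m'| < (C + C') * L `^ e.
  move=> L0.
  have V0 : lattice_box (fun=> 0 * L) (fun=> 1 * L) !=set0.
    exists (0 : lattice d) => j; rewrite mxE mul0r mul1r lexx/=.
    exact: ltW.
  have := HC L 0 L0; rewrite norm0 powR_gt0// => /(_ isT V0) h.
  have := HC' L 0 L0; rewrite norm0 powR_gt0// => /(_ isT V0) h'.
  rewrite mulrDl; apply: le_lt_trans (ltrD h h').
  rewrite (distrC _ m); apply: le_trans (ler_normD _ _).
  by rewrite addrA subrK.
apply/eqP; rewrite -subr_eq0 -normr_eq0; apply: contraT => mm'.
have mm0 : 0 < `|m - m'| by rewrite lt_neqAle eq_sym mm' normr_ge0.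
have D0 : 0 < C + C'.
  by have := lt_trans mm0 (key 1 ltr01); rewrite powR1 mulr1.
have q0 : 0 < `|m - m'| / (C + C') by exact: divr_gt0.
have := key _ (powR_gt0 e^-1 q0).
rewrite -powRrM mulVf ?lt_eqF// powRr1 ?ltW//.
by rewrite mulrC divfK ?gt_eqF// ltxx.
Qed.

End GlobalAverages.

Definition rho (R : realType) (d : nat) (beta : R) : R :=
  if beta <= (d%:R - 1) / d%:R then 1 / 2 else d%:R / 2 * (beta - 1) + 1.

(* Main.v *)
(* Given its value at time [m], the walk at time [m + k] is spread by a kernel
   which is smooth on the scale [sqrt k]: a unit shift changes it by
   [O(k^(-1/2))] in total variation.  Indeed, by aperiodicity and non-degeneracy
   some power of the transition operator contains two atoms of equal mass that
   differ by a given unit vector.  Choosing between them is a fair coin, and the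
   difference of the two shifts is a derivative in the number of heads minus
   tails, whose mean absolute value after [k] rounds is of order [sqrt k] only.
   Hence, up to an arbitrary negative power of [k], [F] may be replaced by its
   average over cubes of side [k^(1/2 - eps)] at both times simultaneously, and
   [E (F(S_m) F(S_(m+k))) = O(k^(-d (1 - beta) + eps))] for [k <= m].  The second
   moment of [T_(a+K) - T_a] is therefore [O(K N^(2 rho - 1 + eps))] for
   [a + K <= N], and dyadic chaining and Borel--Cantelli along the powers of two
   give the almost sure bound.

   As all moments are finite, the probability that one of the first [N] steps
   leaves a cube of side [N^eps] decays faster than any power of [N].  So the
   walk is replaced by words in such steps, and expectations by finite sums. *)
Require Import Defs.
From HB Require Import structures.
From mathcomp Require Import all_boot all_order all_algebra finmap.
From mathcomp Require Import all_classical all_reals all_analysis.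
From mathcomp Require Import measurable_realfun.
From mathcomp Require Import zify ring lra.

Set Implicit Arguments.
Unset Strict Implicit.
Unset Printing Implicit Defensive.

Import Order.TTheory GRing.Theory Num.Theory.
Import numFieldNormedType.Exports.
Local Open Scope classical_set_scope.
Local Open Scope ring_scope.

(** * Finite combinations of translations *)

(** Condition on the first of [m + 1] choices: [a] moves the score [s] to [s + 1], [b] moves it to
    [s - 1], and [r] leaves it. The extra terms add up to [(a - b) * B ^+ m]. *)
Lemma score_step (A : comNzRingType) (a b r : A) (m : nat) (s : int) :
  let B := a + b + r in
  B ^+ m.+1 *~ s + (a - b) * B ^+ m.+1.-1 *+ m.+1 =
    a * (B ^+ m *~ (s + 1) + (a - b) * B ^+ m.-1 *+ m) +
    b * (B ^+ m *~ (s - 1) + (a - b) * B ^+ m.-1 *+ m) +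
    r * (B ^+ m *~ s + (a - b) * B ^+ m.-1 *+ m).
Proof.
move=> B; rewrite !mulrzDr !mulr1z.
have [x Ex] : exists x, forall y : A, y *~ s = y * x.
  by exists s%:~R => y; rewrite mulrzr.
have [n En] : exists n, forall y : A, y *+ m = y * n.
  by exists m%:R => y; rewrite mulr_natr.
rewrite mulrSr !En !Ex mulrNz mulr1z exprS.
case: m En => [|m] En; last by rewrite /= exprS /B; ring.
(* For [m = 0] the exponent [m.-1] is 0 rather than -1, but its coefficient vanishes. *)
have -> : n = 0 by rewrite -[n]mul1r -En.
by rewrite /= expr0 /B; ring.
Qed.

Section TranslationOperators.
Context (R : realType) (G : zmodType).

Definition comb (s : seq (R * G)) (f : G -> R) : G -> R :=
  fun x => \sum_(p <- s) p.1 * f (x + p.2).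

(** Finite signed measures on [G] acting through translations. The representing list is only
    asserted to exist, so equality is equality of functions, and the operators form a commutative
    ring in which identities between kernels are settled by algebra. *)
Record shift_op := ShiftOp {
  shift_op_fun :> (G -> R) -> G -> R ;
  shift_op_comb : exists s, shift_op_fun = comb s }.

HB.instance Definition _ := gen_eqMixin shift_op.
HB.instance Definition _ := gen_choiceMixin shift_op.

Lemma shift_opP (S T : shift_op) : (forall f x, S f x = T f x) -> S = T.
Proof.
case: S T => [S hS] [T hT] /= ST.
have E : S = T by apply/funext => f; apply/funext => x.
by subst T; congr ShiftOp; exact: Prop_irrelevance.
Qed.

Lemma shift_op_lin (T : shift_op) c f g x :
  T (fun y => c * f y + g y) x = c * T f x + T g x.
Proof.
have [s ->] := shift_op_comb T; rewrite /comb mulr_sumr -big_split/=.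
by apply: eq_bigr => p _; rewrite mulrDr mulrCA.
Qed.

Lemma shift_opD (T : shift_op) f g x : T (fun y => f y + g y) x = T f x + T g x.
Proof.
rewrite -[T f x]mul1r -shift_op_lin.
by congr (T _ _); apply/funext => y; rewrite mul1r.
Qed.

Lemma shift_op0 (T : shift_op) x : T (fun=> 0) x = 0.
Proof. by have [s ->] := shift_op_comb T; rewrite /comb big1// => p _; rewrite mulr0. Qed.

Lemma shift_opN (T : shift_op) f x : T (fun y => - f y) x = - T f x.
Proof.
rewrite -mulN1r -[_ * _]addr0 -(shift_op0 T x) -shift_op_lin.
by congr (T _ _); apply/funext => y; rewrite addr0 mulN1r.
Qed.

Fact zero_comb : exists s, (fun (_ : G -> R) (_ : G) => 0 : R) = comb s.
Proof. by exists [::]; apply/funext => f; apply/funext => x; rewrite /comb big_nil. Qed.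

Fact scaled_translation_comb c v :
  exists s, (fun (f : G -> R) x => c * f (x + v)) = comb s.
Proof.
exists [:: (c, v)]; apply/funext => f; apply/funext => x.
by rewrite /comb big_cons big_nil addr0.
Qed.

Fact add_comb (S T : shift_op) : exists s, (fun f x => S f x + T f x) = comb s.
Proof.
have [s ->] := shift_op_comb S; have [t ->] := shift_op_comb T; exists (s ++ t).
by apply/funext => f; apply/funext => x; rewrite /comb big_cat.
Qed.

Fact opp_comb (T : shift_op) : exists s, (fun f x => - T f x) = comb s.
Proof.
have [t ->] := shift_op_comb T; exists [seq (- p.1, p.2) | p <- t].
apply/funext => f; apply/funext => x; rewrite /comb big_map -sumrN.
by apply: eq_bigr => p _; rewrite mulNr.
Qed.

Fact mul_comb (S T : shift_op) : exists s, (fun f => S (T f)) = comb s.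
Proof.
have [s ->] := shift_op_comb S; have [t ->] := shift_op_comb T.
exists [seq (p.1 * q.1, p.2 + q.2) | p <- s, q <- t].
apply/funext => f; apply/funext => x; rewrite /comb big_allpairs_dep/=.
apply: eq_bigr => p _; rewrite mulr_sumr; apply: eq_bigr => q _.
by rewrite mulrA addrA.
Qed.

Definition shift_op_zero := ShiftOp zero_comb.
Definition tau c v := ShiftOp (scaled_translation_comb c v).
Definition shift_op_add S T := ShiftOp (add_comb S T).
Definition shift_op_opp T := ShiftOp (opp_comb T).
Definition shift_op_mul S T := ShiftOp (mul_comb S T).

Fact shift_op_addA : associative shift_op_add.
Proof. by move=> S T U; apply: shift_opP => f x /=; rewrite addrA. Qed.
Fact shift_op_addC : commutative shift_op_add.
Proof. by move=> S T; apply: shift_opP => f x /=; rewrite addrC. Qed.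
Fact shift_op_add0 : left_id shift_op_zero shift_op_add.
Proof. by move=> S; apply: shift_opP => f x /=; rewrite add0r. Qed.
Fact shift_op_addN : left_inverse shift_op_zero shift_op_opp shift_op_add.
Proof. by move=> S; apply: shift_opP => f x /=; rewrite addNr. Qed.

HB.instance Definition _ :=
  GRing.isZmodule.Build shift_op shift_op_addA shift_op_addC shift_op_add0 shift_op_addN.

Fact shift_op_mulA : associative shift_op_mul.
Proof. by move=> S T U; apply: shift_opP. Qed.
Fact shift_op_mulC : commutative shift_op_mul.
Proof.
move=> S T; apply: shift_opP => f x /=.
have [s ->] := shift_op_comb S; have [t ->] := shift_op_comb T; rewrite /comb.
under eq_bigr do rewrite mulr_sumr.
rewrite exchange_big/=; apply: eq_bigr => p _; rewrite mulr_sumr.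
by apply: eq_bigr => q _; rewrite mulrCA -!addrA (addrC p.2).
Qed.
Fact shift_op_mul1 : left_id (tau 1 0) shift_op_mul.
Proof. by move=> S; apply: shift_opP => f x /=; rewrite mul1r addr0. Qed.
Fact shift_op_mulDl : left_distributive shift_op_mul shift_op_add.
Proof. by move=> S T U; apply: shift_opP. Qed.
Fact shift_op_oner_neq0 : tau 1 0 != shift_op_zero.
Proof.
apply/eqP => /(congr1 (fun T : shift_op => T (fun=> 1) 0)) /= /eqP.
by rewrite mulr1 oner_eq0.
Qed.

HB.instance Definition _ := GRing.Zmodule_isComNzRing.Build shift_op
  shift_op_mulA shift_op_mulC shift_op_mul1 shift_op_mulDl shift_op_oner_neq0.

Implicit Types (S T : shift_op) (f g : G -> R) (c : R) (v w x : G).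

Lemma shift_op_addE S T f x : (S + T) f x = S f x + T f x. Proof. by []. Qed.
Lemma shift_op_oppE T f x : (- T) f x = - T f x. Proof. by []. Qed.
Lemma shift_op_mulE S T f x : (S * T) f x = S (T f) x. Proof. by []. Qed.
Lemma tauE c v f x : tau c v f x = c * f (x + v). Proof. by []. Qed.
Lemma shift_op_oneE f x : (1 : shift_op) f x = f x.
Proof. by rewrite tauE mul1r addr0. Qed.

Lemma shift_op_sumE (I : Type) (r : seq I) (P : pred I) (F : I -> shift_op) f x :
  (\sum_(i <- r | P i) F i) f x = \sum_(i <- r | P i) F i f x.
Proof. by apply: (big_morph (fun T : shift_op => T f x)). Qed.

Lemma shift_op_mulrnE T m f x : (T *+ m) f x = T f x *+ m.
Proof. by elim: m => // m IH; rewrite !mulrS shift_op_addE IH. Qed.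

Lemma tauM c c' v w : tau c v * tau c' w = tau (c * c') (v + w).
Proof. by apply: shift_opP => f x; rewrite shift_op_mulE !tauE mulrA addrA. Qed.

Lemma tau10 : tau 1 0 = 1. Proof. by []. Qed.

Lemma tau_prod (I : finType) (c : I -> R) (v : I -> G) :
  \prod_i tau (c i) (v i) = tau (\prod_i c i) (\sum_i v i).
Proof.
elim/big_rec3: _ => [//|i T y1 y2 _ ->]; by rewrite tauM.
Qed.

(** An upper bound for the operator norm on bounded functions; for nonnegative weights the total
    mass is such a bound. *)
Definition bnd T c :=
  forall f (M : R), (forall x, `|f x| <= M) -> forall x, `|T f x| <= c * M.

Lemma bnd_ge0 T c : bnd T c -> 0 <= c.
Proof.
move=> /(_ (fun=> 0) 1) h; rewrite -[c]mulr1.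
by apply: le_trans (h _ 0) => // x; rewrite normr0.
Qed.

Lemma bndW T c c' : bnd T c -> c <= c' -> bnd T c'.
Proof.
move=> h cc' f M fM x; apply: le_trans (h _ _ fM x) _.
by apply: ler_wpM2r => //; exact: le_trans (normr_ge0 _) (fM 0).
Qed.

Lemma bndD S T c c' : bnd S c -> bnd T c' -> bnd (S + T) (c + c').
Proof.
move=> hS hT f M fM x; rewrite shift_op_addE mulrDl.
by apply: le_trans (ler_normD _ _) _; apply: lerD; [exact: hS|exact: hT].
Qed.

Lemma bndN T c : bnd T c -> bnd (- T) c.
Proof. by move=> h f M fM x; rewrite shift_op_oppE normrN; exact: h. Qed.

Lemma bndM S T c c' : bnd S c -> bnd T c' -> bnd (S * T) (c * c').
Proof. by move=> hS hT f M fM x; rewrite -mulrA; apply: hS => y; exact: hT. Qed.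

Lemma bnd_tau c v : bnd (tau c v) `|c|.
Proof. by move=> f M fM x; rewrite tauE normrM ler_wpM2l. Qed.

Lemma bnd_tau_ge0 c v : 0 <= c -> bnd (tau c v) c.
Proof. by move=> c0; rewrite -{2}(ger0_norm c0); exact: bnd_tau. Qed.

Lemma bnd0 : bnd 0 0.
Proof. by move=> f M fM x; rewrite mul0r normr0. Qed.

Lemma bnd1 : bnd 1 1.
Proof. by have := @bnd_tau 1 0; rewrite normr1. Qed.

Lemma bndX T c n : bnd T c -> bnd (T ^+ n) (c ^+ n).
Proof.
move=> h; elim: n => [|n IH]; first by rewrite !expr0; exact: bnd1.
by rewrite !exprS; exact: bndM.
Qed.

Lemma bnd_sum (I : Type) (r : seq I) (P : pred I) (F : I -> shift_op) (c : I -> R) :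
  (forall i, P i -> bnd (F i) (c i)) ->
  bnd (\sum_(i <- r | P i) F i) (\sum_(i <- r | P i) c i).
Proof.
move=> h; elim/big_rec2: _ => [|i a T Pi hT]; first exact: bnd0.
by apply: bndD => //; exact: h.
Qed.

Lemma bnd_eval T c f (M : R) x : bnd T c -> (forall y, `|f y| <= M) -> `|T f x| <= c * M.
Proof. by move=> h fM; exact: h. Qed.

Lemma bndMn T c m : bnd (T *+ m.+1) c -> bnd T (c / m.+1%:R).
Proof.
move=> h f M fM x; have := h f M fM x.
by rewrite shift_op_mulrnE normrMn mulrAC ler_pdivlMr ?ltr0n// mulr_natr.
Qed.

(* The left-hand side is the expectation of [(s + N) f(x + S)], where [S] is
   the sum of the shifts drawn by [m] independent choices among [a], [b] and
   [r], and [N] counts the choices of [a] minus those of [b]. *)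
Lemma bnd_score (a b r : shift_op) (theta lam : R) : 0 <= theta <= 1 -> 0 < lam ->
  bnd a (theta / 2) -> bnd b (theta / 2) -> bnd r (1 - theta) ->
  forall (m : nat) (s : int),
  bnd ((a + b + r) ^+ m *~ s + (a - b) * (a + b + r) ^+ m.-1 *+ m)
      (lam * (s%:~R ^+ 2 + m%:R * theta) / 2 + (lam * 2)^-1).
Proof.
move=> th lam0 ha hb hr; elim=> [|m IH] s.
  rewrite mulr0n addr0 expr0 mul0r addr0.
  have hs : bnd (1 *~ s) `|s%:~R|.
    have -> : 1 *~ s = tau s%:~R 0 :> shift_op.
      case: s => n; apply: shift_opP => f x; rewrite tauE.
        by rewrite -pmulrn shift_op_mulrnE shift_op_oneE addr0 -mulr_natl.
      rewrite NegzE mulrNz mulrNz shift_op_oppE -pmulrn shift_op_mulrnE shift_op_oneE addr0.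
      by rewrite mulNr -mulr_natl.
    exact: bnd_tau.
  apply: bndW hs _.
  (* This is [|s| <= lam s^2 / 2 + 1 / (2 lam)], that is [(lam |s| - 1)^2 >= 0]. *)
  rewrite -subr_ge0 -(pmulr_lge0 _ lam0).
  have := sqr_ge0 (lam * `|s%:~R| - 1); rewrite -(real_normK (num_real s%:~R)).
  set t := `|_|.
  suff -> : (lam * t ^+ 2 / 2 + (lam * 2)^-1 - t) * lam = (lam * t - 1) ^+ 2 / 2.
    by move=> _; rewrite divr_ge0// sqr_ge0.
  by field; rewrite gt_eqF.
set B := a + b + r in IH *.
rewrite score_step -/B.
(* The mean of [(s + 1)^2], [(s - 1)^2] and [s^2] with masses [theta / 2], [theta / 2] and
   [1 - theta] is [s^2 + theta], so each round raises the second moment by [theta]. *)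
have h := bndD (bndD (bndM ha (IH (s + 1))) (bndM hb (IH (s - 1))))
                (bndM hr (IH s)).
apply: bndW h _; rewrite intrB intrD -natr1 le_eqVlt; apply/orP; left; apply/eqP.
by field; rewrite gt_eqF.
Qed.

End TranslationOperators.

(** * Smoothness of operators along shifts, averages and ranges *)

Lemma geometric_splitting (A : comNzRingType) (u : A) (r : nat) :
  1 = u * (\sum_(i < r) (1 - u) ^+ i) + (1 - u) ^+ r.
Proof.
elim: r => [|r IH]; first by rewrite big_ord0 mulr0 add0r.
rewrite [LHS]IH big_ord_recr /= exprS; ring.
Qed.

Section Smoothness.
Context (R : realType) (G : zmodType).
Implicit Types (T K u : shift_op R G) (c eta : R) (v w : G).

(** Smoothness along [v] in total variation. *)
Definition shift_bnd K v eta := bnd ((1 - tau 1 v) * K) eta.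

Lemma shift_bnd0 K : shift_bnd K 0 0.
Proof. by rewrite /shift_bnd tau10 subrr mul0r; exact: bnd0. Qed.

Lemma shift_bndD K v w eta eta' :
  shift_bnd K v eta -> shift_bnd K w eta' -> shift_bnd K (v + w) (eta + eta').
Proof.
move=> hv hw; rewrite /shift_bnd.
have -> : (1 - tau 1 (v + w)) * K =
    (1 - tau 1 v) * K + tau (1 : R) v * ((1 - tau 1 w) * K).
  by rewrite mulrA mulrBr mulr1 tauM mulr1 -mulrDl addrA subrK.
apply: bndD hv _; rewrite -[eta']mul1r.
by apply: bndM hw; exact: bnd_tau_ge0.
Qed.

Lemma shift_bndN K v eta : shift_bnd K v eta -> shift_bnd K (- v) eta.
Proof.
move=> hv; rewrite /shift_bnd.
have -> : (1 - tau 1 (- v)) * K = tau (- 1) (- v) * ((1 - tau 1 v) * K).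
  rewrite mulrA mulrBr mulr1 tauM mulr1 addNr.
  have -> : tau (- 1) (- v) = - tau (1 : R) (- v).
    by apply: shift_opP => f x; rewrite shift_op_oppE !tauE mulN1r mul1r.
  have -> : tau (- 1) 0 = - 1 :> shift_op R G.
    by apply: shift_opP => f x; rewrite shift_op_oppE shift_op_oneE tauE mulN1r addr0.
  by rewrite opprK addrC.
have h := @bnd_tau R G (- 1) (- v); rewrite normrN1 in h.
by rewrite -[eta]mul1r; exact: bndM.
Qed.

Lemma shift_bndM K K' v eta :
  shift_bnd K v eta -> bnd K' 1 -> shift_bnd (K * K') v eta.
Proof. by move=> hK hK'; rewrite /shift_bnd mulrA -[eta]mulr1; exact: bndM. Qed.

Lemma shift_bndMn K v eta m : shift_bnd K v eta -> shift_bnd K (v *+ m) (eta *+ m).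
Proof.
move=> h; elim: m => [|m IH]; first by rewrite !mulr0n; exact: shift_bnd0.
by rewrite !mulrS; exact: shift_bndD.
Qed.

Lemma shift_bnd_sum K (I : Type) (r : seq I) (v : I -> G) (eta : I -> R) :
  (forall i, shift_bnd K (v i) (eta i)) ->
  shift_bnd K (\sum_(i <- r) v i) (\sum_(i <- r) eta i).
Proof.
move=> h; elim/big_rec2: _ => [|i x y _ hxy]; first exact: shift_bnd0.
exact: shift_bndD.
Qed.

Definition average_op (I : finType) (v : I -> G) : shift_op R G :=
  \sum_i tau (#|I|%:R^-1) (v i).

Lemma sum_inv_card (I : finType) : (0 < #|I|)%N -> \sum_(i in I) (#|I|%:R^-1 : R) = 1.
Proof. by move=> I0; rewrite sumr_const -[_ *+ _]mulr_natr mulVf// pnatr_eq0 -lt0n. Qed.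

Lemma bnd_average_op (I : finType) (v : I -> G) :
  (0 < #|I|)%N -> bnd (average_op v) 1.
Proof.
move=> I0; rewrite -(sum_inv_card I0); apply: bnd_sum => i _.
by apply: bnd_tau_ge0; rewrite invr_ge0.
Qed.

(** As the weights of the average add up to 1, [1 - average_op v] is the average of the operators
    [1 - tau 1 (v i)]. *)
Lemma bnd_one_sub_average_op (I : finType) (v : I -> G) K eta :
  (0 < #|I|)%N -> (forall i, shift_bnd K (v i) eta) ->
  bnd ((1 - average_op v) * K) eta.
Proof.
move=> I0 h.
have -> : (1 - average_op v) * K =
    \sum_i tau (#|I|%:R^-1) 0 * ((1 - tau 1 (v i)) * K).
  rewrite -mulr_sumr -mulr_suml mulrA; congr (_ * _).
  rewrite sumrB mulrBr mulr_sumr [in RHS]mulr_sumr; congr (_ - _).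
    under eq_bigr do rewrite mulr1.
    apply: shift_opP => f x; rewrite shift_op_sumE shift_op_oneE.
    under eq_bigr do rewrite tauE addr0.
    by rewrite -mulr_suml sum_inv_card// mul1r.
  by apply: eq_bigr => i _; rewrite tauM mulr1 add0r.
have <- : (\sum_(i in I) #|I|%:R^-1) * eta = eta by rewrite sum_inv_card ?mul1r.
rewrite mulr_suml; apply: bnd_sum => i _.
by apply: bndM; [apply: bnd_tau_ge0; rewrite invr_ge0|exact: h].
Qed.

End Smoothness.

(** * Operators of finite range *)

Section Range.
Context (R : realType) (G : zmodType) (sz : G -> nat)
  (sz0 : sz 0 = 0%N) (szD : forall v w, (sz (v + w)%R <= sz v + sz w)%N).
Implicit Types (T : shift_op R G).

(** Locality is read off the action, since the list behind an operator is not unique: the value at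
    [x] depends on [f] only within distance [k] of [x]. *)
Definition in_range T (k : nat) :=
  forall f x, (forall v, (sz v <= k)%N -> f (x + v) = 0) -> T f x = 0.

Lemma in_rangeW T k k' : in_range T k -> (k <= k')%N -> in_range T k'.
Proof. by move=> h kk' f x fx; apply: h => v vk; apply: fx; exact: leq_trans kk'. Qed.

Lemma in_range0 k : in_range 0 k. Proof. by []. Qed.

Lemma in_range_tau c v k : (sz v <= k)%N -> in_range (tau c v) k.
Proof. by move=> vk f x fx; rewrite tauE fx// mulr0. Qed.

Lemma in_range1 k : in_range 1 k.
Proof. by rewrite -tau10; apply: in_range_tau; rewrite sz0. Qed.

Lemma in_rangeD S T k : in_range S k -> in_range T k -> in_range (S + T) k.
Proof. by move=> hS hT f x fx; rewrite shift_op_addE hS// hT// addr0. Qed.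

Lemma in_rangeN T k : in_range T k -> in_range (- T) k.
Proof. by move=> hT f x fx; rewrite shift_op_oppE hT// oppr0. Qed.

Lemma in_rangeM S T k k' : in_range S k -> in_range T k' -> in_range (S * T) (k + k').
Proof.
move=> hS hT f x fx; rewrite shift_op_mulE; apply: hS => v vk; apply: hT => w wk.
by rewrite -addrA; apply: fx; apply: leq_trans (szD _ _) _; exact: leq_add.
Qed.

Lemma in_range_sum (I : Type) (r : seq I) (F : I -> shift_op R G) k :
  (forall i, in_range (F i) k) -> in_range (\sum_(i <- r) F i) k.
Proof.
move=> h; elim/big_ind: _ => [|S T hS hT|i _]; [exact: in_range0|exact: in_rangeD|exact: h].
Qed.

Lemma in_rangeX T k n : in_range T k -> in_range (T ^+ n) (n * k).
Proof.
move=> h; elim: n => [|n IH]; first exact: in_range1.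
by rewrite exprS mulSn; exact: in_rangeM.
Qed.

(** Replacing [f] by 0 outside the ball of radius [k] around [x] does not change [T f x], and the
    modified function is bounded by [delta] everywhere. *)
Lemma bnd_in_range T c k f x (delta : R) : bnd T c -> in_range T k -> 0 <= delta ->
  (forall v, (sz v <= k)%N -> `|f (x + v)| <= delta) -> `|T f x| <= c * delta.
Proof.
move=> hT kT d0 fd.
pose g y := if (sz (y - x) <= k)%N then f y else 0.
have -> : T f x = T g x.
  apply/eqP; rewrite -subr_eq0 -shift_opN -shift_opD; apply/eqP; apply: kT => v vk.
  by rewrite /g [x + v]addrC addrK vk subrr.
apply: hT => y; rewrite /g; case: ifP => [yk|_]; last by rewrite normr0.
by have := fd _ yk; rewrite addrC subrK.
Qed.

(* Writing [1 = u Q + (1 - u)^r] in both directions, every term but the one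
   with [u1 * u2] contains the [r]-th power of a small operator. *)
Lemma two_average_bound (kappa K u1 u2 : shift_op R G) (r k1 k2 k3 : nat)
    (eta delta M : R) (Phi : G -> R) :
  bnd kappa 1 -> bnd K 1 -> bnd u1 1 -> bnd u2 1 ->
  bnd ((1 - u1) * K) eta -> bnd ((1 - u2) * K) eta ->
  in_range kappa k1 -> in_range K k2 -> in_range u1 k3 -> in_range u2 k3 ->
  (forall y, `|Phi y| <= M) -> 0 <= delta ->
  (forall v, (sz v <= k1 + r * k2 + 2 * (r * k3))%N -> `|(u1 * u2) Phi v| <= delta) ->
  `|(kappa * K ^+ r) Phi 0| <= 4 ^+ r * delta + 2 ^+ r.+1 * eta ^+ r * M.
Proof.
move=> hk hK hu1 hu2 he1 he2 rk rK ru1 ru2 PhiM d0 hd.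
pose Q (u : shift_op R G) : shift_op R G := \sum_(i < r) (1 - u) ^+ i.
have QE u : 1 = u * Q u + (1 - u) ^+ r by exact: geometric_splitting.
(* Each [1 - u] has norm at most 2, and the powers of 2 below [2 ^ r] add up to [2 ^ r - 1]. *)
have hQ u : bnd u 1 -> bnd (Q u) (2 ^+ r).
  move=> hu; apply: (@bndW _ _ _ (\sum_(i < r) 2 ^+ i)).
    apply: bnd_sum => i _; apply: bndX; have := bndD (@bnd1 R G) (bndN hu).
    by rewrite (_ : 1 + 1 = 2).
  have := subrX1 (2 : R) r; rewrite (_ : 2 - 1 = 1 :> R); last by ring.
  by rewrite mul1r => <-; rewrite gerBl.
have rQ u : in_range u k3 -> in_range (Q u) (r * k3).
  move=> hu; apply: in_range_sum => i.
  apply: (@in_rangeW _ (i * k3)); last by rewrite leq_mul2r ltnW ?orbT.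
  by apply: in_rangeX; apply: in_rangeD; [exact: in_range1|exact: in_rangeN].
(* Split along [u2], then split the part with [u2 * Q u2] along [u1]; each factor [1 - u] is paired
   with one factor [K]. *)
have -> : kappa * K ^+ r =
    kappa * K ^+ r * (Q u1 * Q u2) * (u1 * u2)
    + kappa * ((1 - u1) * K) ^+ r * (u2 * Q u2)
    + kappa * ((1 - u2) * K) ^+ r.
  rewrite !exprMn.
  transitivity (kappa * K ^+ r * ((u1 * Q u1 + (1 - u1) ^+ r) * (u2 * Q u2) + (1 - u2) ^+ r)).
    by rewrite -QE mul1r -QE mulr1.
  by move: (Q u1) (Q u2) ((1 - u1) ^+ r) ((1 - u2) ^+ r) (K ^+ r) => *; ring.
rewrite 2!shift_op_addE.
have M0 : 0 <= M by exact: le_trans (normr_ge0 _) (PhiM 0).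
have e0 : 0 <= eta by exact: bnd_ge0 he1.
have b1 : `|(kappa * K ^+ r * (Q u1 * Q u2) * (u1 * u2)) Phi 0| <= 4 ^+ r * delta.
  rewrite (_ : 4 ^+ r = 1 * 1 ^+ r * (2 ^+ r * 2 ^+ r)); last first.
    by rewrite expr1n !mul1r -exprMn; congr (_ ^+ _); ring.
  rewrite shift_op_mulE; apply: (@bnd_in_range _ _ (k1 + r * k2 + (r * k3 + r * k3))).
  - by apply: bndM; [apply: bndM => //; exact: bndX|apply: bndM; exact: hQ].
  - by apply: in_rangeM; apply: in_rangeM => //; [exact: in_rangeX|exact: rQ|exact: rQ].
  - by [].
  - by move=> v; rewrite add0r => hv; apply: hd; rewrite mul2n -addnn.
have b2 : `|(kappa * ((1 - u1) * K) ^+ r * (u2 * Q u2)) Phi 0| <=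
    1 * eta ^+ r * (1 * 2 ^+ r) * M.
  apply: (bnd_eval (M := M)) => //; apply: bndM; first by apply: bndM => //; exact: bndX.
  by apply: bndM => //; exact: hQ.
have b3 : `|(kappa * ((1 - u2) * K) ^+ r) Phi 0| <= 1 * eta ^+ r * M.
  by apply: (bnd_eval (M := M)) => //; apply: bndM => //; exact: bndX.
apply: le_trans (ler_normD _ _) _; apply: le_trans (lerD (ler_normD _ _) (lexx _)) _.
apply: le_trans (lerD (lerD b1 b2) b3) _; rewrite -addrA lerD2l -mulrDl ler_wpM2r//.
rewrite !mul1r mulrC exprS -mulrA mulrDl mul1r lerD2l.
by rewrite ler_peMl ?exprn_ge0// exprn_ege1// ler1n.
Qed.

End Range.

(** * Smoothing by random steps *)

Section StepOperators.
Context (R : realType) (V : finType) (p : V -> R).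
Context (p_ge0 : forall v, 0 <= p v) (p_le1 : \sum_v p v <= 1).

Definition word_weight n (w : {ffun 'I_n -> V}) : R := \prod_i p (w i).

Lemma word_weight_ge0 n (w : {ffun 'I_n -> V}) : 0 <= word_weight w.
Proof. exact: prodr_ge0. Qed.

Lemma sum_word_weight n : \sum_(w : {ffun 'I_n -> V}) word_weight w <= 1.
Proof.
rewrite /word_weight -(bigA_distr_bigA (fun (_ : 'I_n) v => p v)) prodr_const exprn_ile1//.
exact: sumr_ge0.
Qed.

Context (G : zmodType).

Definition step_op (phi : V -> G) : shift_op R G := \sum_v tau (p v) (phi v).

Lemma bnd_step_op phi : bnd (step_op phi) 1.
Proof. by apply: bndW p_le1; apply: bnd_sum => v _; exact: bnd_tau_ge0. Qed.

Lemma prod_step_op n (phi : 'I_n -> V -> G) :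
  \prod_i step_op (phi i) =
  \sum_(w : {ffun 'I_n -> V}) tau (word_weight w) (\sum_i phi i (w i)).
Proof. by rewrite bigA_distr_bigA/=; apply: eq_bigr => w _; rewrite tau_prod. Qed.

Lemma step_opX n phi : step_op phi ^+ n =
  \sum_(w : {ffun 'I_n -> V}) tau (word_weight w) (\sum_i phi (w i)).
Proof. by rewrite -(prod_step_op (fun=> phi)) prodr_const card_ord. Qed.

(** Taking mass [h] off two different words leaves nonnegative weights, so the norm of the rest is
    at most its total mass. *)
Lemma bnd_sub_pair n (phi : V -> G) (w1 w2 : {ffun 'I_n -> V}) (h : R) :
  w1 != w2 -> h <= word_weight w1 -> h <= word_weight w2 ->
  bnd (step_op phi ^+ n - tau h (\sum_i phi (w1 i)) - tau h (\sum_i phi (w2 i)))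
      (1 - h *+ 2).
Proof.
move=> w12 h1 h2.
pose c w : R := word_weight w - (if (w == w1) || (w == w2) then h else 0).
have c0 w : 0 <= c w.
  rewrite /c; case: ifPn => [/orP[]/eqP->|_]; rewrite ?subr0 ?subr_ge0//.
  exact: word_weight_ge0.
have sum_pair (U : nmodType) (F : {ffun 'I_n -> V} -> U) :
    \sum_w (if (w == w1) || (w == w2) then F w else 0) = F w1 + F w2.
  rewrite (bigD1 w1)//= eqxx/= (bigD1 w2) 1?eq_sym//= eqxx orbT big1 ?addr0//.
  by move=> w /andP[/negPf-> /negPf->].
have -> : step_op phi ^+ n - tau h (\sum_i phi (w1 i)) - tau h (\sum_i phi (w2 i)) =
    \sum_w tau (c w) (\sum_i phi (w i)).
  apply/eqP; rewrite -addrA -opprD subr_eq step_opX.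
  rewrite -(sum_pair _ (fun w => tau h (\sum_i phi (w i)))) -big_split/=.
  apply/eqP/eq_bigr => w _; apply: shift_opP => f x; rewrite shift_op_addE !tauE /c.
  by case: ifP => _; rewrite ?tauE /= ?subr0 ?addr0// mulrBl subrK.
have -> : 1 - h *+ 2 = 1 - \sum_w (if (w == w1) || (w == w2) then h else 0).
  by rewrite (sum_pair _ (fun=> h)) mulr2n.
apply: (@bndW _ _ _ (\sum_w c w)); last by rewrite sumrB lerD2r sum_word_weight.
by apply: bnd_sum => w _; exact: bnd_tau_ge0.
Qed.

(** A block of [n] steps is [w1] or [w2] with mass [h] each, which is a fair coin of total mass
    [2 h]. By the score bound, the difference of the two outcomes followed by [m] blocks is of order
    [1 / sqrt m], and [l] steps contain [l %/ n] blocks. *)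
Lemma step_op_smoothing n (phi : V -> G) (w1 w2 : {ffun 'I_n -> V}) (h : R) (l : nat) :
  0 < h -> h <= word_weight w1 -> h <= word_weight w2 -> w1 != w2 ->
  shift_bnd (step_op phi ^+ l) (\sum_i phi (w2 i) - \sum_i phi (w1 i))
    (Num.sqrt (2 * n%:R / h / l.+1%:R)).
Proof.
move=> h0 h1 h2 w12.
have n0 : (0 < n)%N.
  case: n w1 w2 w12 {h1 h2} => // w1 w2 /eqP[]; apply/ffunP => -[]//.
set x1 := \sum_i phi (w1 i); set x2 := \sum_i phi (w2 i).
pose m := (l %/ n)%N; pose a : shift_op R G := tau h x1; pose b : shift_op R G := tau h x2.
pose rr := step_op phi ^+ n - a - b.
have th : 0 <= h *+ 2 <= 1.
  apply/andP; split; first by rewrite mulrn_wge0// ltW.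
  by have := bnd_ge0 (bnd_sub_pair phi w12 h1 h2); rewrite subr_ge0.
have hh : h *+ 2 / 2 = h by rewrite -[h *+ 2]mulr_natr mulfK// pnatr_eq0.
have ha : bnd a (h *+ 2 / 2) by rewrite hh; apply: bnd_tau_ge0; exact: ltW.
have hb : bnd b (h *+ 2 / 2) by rewrite hh; apply: bnd_tau_ge0; exact: ltW.
have hr : bnd rr (1 - h *+ 2) by exact: bnd_sub_pair.
(* [q] is the standard deviation of the score after [m + 1] rounds, and [lam = q^-1] minimises the
   score bound. *)
pose q : R := Num.sqrt (m.+1%:R * (h *+ 2)).
have q0 : 0 < q by rewrite sqrtr_gt0 mulr_gt0 ?ltr0n// mulrn_wgt0.
have q2 : q ^+ 2 = m.+1%:R * (h *+ 2).
  by rewrite sqr_sqrtr// mulr_ge0// mulrn_wge0// ltW.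
have := bnd_score th (_ : 0 < q^-1) ha hb hr m.+1 0.
rewrite invr_gt0 => /(_ q0); rewrite mulr0z add0r /=.
have -> : a + b + rr = step_op phi ^+ n by rewrite /rr; ring.
rewrite -exprM => /bndMn hab; rewrite /shift_bnd.
(* Translating by [- x1] and dividing by [h] turns [a - b] into [1 - tau 1 (x2 - x1)]; the remaining
   [l %% n] steps have norm at most 1. *)
have -> : (1 - tau 1 (x2 - x1)) * step_op phi ^+ l =
    tau h^-1 (- x1) * ((a - b) * step_op phi ^+ (n * m)) * step_op phi ^+ (l %% n).
  rewrite -!mulrA -exprD mulnC -divn_eq mulrA; congr (_ * _).
  by rewrite /a /b mulrBr !tauM mulVf ?gt_eqF// addNr [x2 - x1]addrC.
apply: (@bndW _ _ _ (h^-1 * ((q^-1 * ((0%:~R) ^+ 2 + m.+1%:R * (h *+ 2)) / 2 +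
    (q^-1 * 2)^-1) / m.+1%:R) * 1)).
  apply: bndM; last by rewrite -(expr1n _ (l %% n)); apply: bndX; exact: bnd_step_op.
  by apply: bndM hab; apply: bnd_tau_ge0; rewrite invr_ge0 ltW.
rewrite mulr1 expr0n add0r -q2.
have -> : h^-1 * ((q^-1 * q ^+ 2 / 2 + (q^-1 * 2)^-1) / m.+1%:R) = h^-1 * (q / m.+1%:R).
  by field; rewrite !gt_eqF//= ?ltr0n// addr_gt0.
rewrite -[X in X <= _]ger0_norm; last first.
  by rewrite mulr_ge0 ?invr_ge0 ?divr_ge0 ?ltW.
rewrite -sqrtr_sqr ler_wsqrtr// !exprMn q2.
have -> : h^-1 ^+ 2 * (m.+1%:R * (h *+ 2) * m.+1%:R^-1 ^+ 2) = 2 / h / m.+1%:R.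
  by rewrite -[h *+ 2]mulr_natr; field; rewrite !gt_eqF//= ltr0n.
rewrite ler_pdivrMr ?ltr0n// mulrAC ler_pdivlMr ?ltr0n//.
have -> : 2 * n%:R / h * m.+1%:R = 2 / h * (n * m.+1)%:R by rewrite natrM; ring.
apply: ler_wpM2l; first by rewrite divr_ge0// ltW.
by rewrite ler_nat mulnC; exact: ltn_ceil.
Qed.

End StepOperators.

(** * Correlations along words *)

Section SupNorm.
Context (d : nat).
Implicit Types x y : lattice d.

Definition sup_norm x : nat := \max_(j < d) `|x ord0 j|%N.

Lemma sup_normP x k : reflect (forall j, (`|x ord0 j| <= k)%N) (sup_norm x <= k)%N.
Proof.
by apply: (iffP (bigmax_leqP _ _ _)) => h j; [apply: h|move=> _; apply: h].
Qed.

Lemma sup_norm0 : sup_norm 0 = 0%N.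
Proof. by apply/eqP; rewrite -leqn0; apply/sup_normP => j; rewrite mxE. Qed.

Lemma sup_normD x y : (sup_norm (x + y)%R <= sup_norm x + sup_norm y)%N.
Proof.
apply/sup_normP => j; rewrite mxE.
have hx := sup_normP x _ (leqnn _) j; have hy := sup_normP y _ (leqnn _) j.
by apply: leq_trans (leq_add hx hy); move: (x _ _) (y _ _) => a b; lia.
Qed.

Definition pair_norm (x : lattice d * lattice d) : nat :=
  maxn (sup_norm x.1) (sup_norm x.2).

Lemma pair_norm0 : pair_norm 0 = 0%N.
Proof. by rewrite /pair_norm !sup_norm0. Qed.

Lemma pair_normD (x y : lattice d * lattice d) :
  (pair_norm (x + y)%R <= pair_norm x + pair_norm y)%N.
Proof.
rewrite /pair_norm; have := sup_normD x.1 y.1; have := sup_normD x.2 y.2.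
rewrite /=; lia.
Qed.

Definition unit_vec (j : 'I_d) : lattice d := delta_mx ord0 j.

Definition cube_point (n : nat) (y : {ffun 'I_d -> 'I_n.+1}) : lattice d := \row_j (y j)%:Z.

Definition cube_average (R : realType) (F : lattice d -> R) (n : nat) (x : lattice d) : R :=
  #|{ffun 'I_d -> 'I_n.+1}|%:R^-1 * \sum_(y : {ffun 'I_d -> 'I_n.+1}) F (x + cube_point y).

Lemma cube_point_sum (n : nat) (y : {ffun 'I_d -> 'I_n.+1}) :
  cube_point y = \sum_j unit_vec j *+ y j.
Proof.
rewrite [LHS]matrix_sum_delta big_ord1; apply: eq_bigr => j _.
by rewrite mxE -scaler_nat natz.
Qed.

Lemma sup_norm_cube_point (n : nat) (y : {ffun 'I_d -> 'I_n.+1}) : (sup_norm (cube_point y) <= n)%N.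
Proof. by apply/sup_normP => j; rewrite mxE /=; exact: leq_ord. Qed.

(** In the pair of positions at two times, a step before both acts as [dup] and a step between them
    as [inr0]; [inl0] is the difference of the two. *)
Definition dup x : lattice d * lattice d := (x, x).
Definition inl0 x : lattice d * lattice d := (x, 0).
Definition inr0 x : lattice d * lattice d := (0, x).

Fact dup_zmod_morphism : zmod_morphism dup.
Proof. by []. Qed.
Fact inl0_zmod_morphism : zmod_morphism inl0.
Proof. by move=> x y; rewrite /inl0 -[0 in LHS](subrr 0). Qed.
Fact inr0_zmod_morphism : zmod_morphism inr0.
Proof. by move=> x y; rewrite /inr0 -[0 in LHS](subrr 0). Qed.

HB.instance Definition _ :=
  GRing.isZmodMorphism.Build (lattice d) (lattice d * lattice d)%type dup dup_zmod_morphism.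
HB.instance Definition _ :=
  GRing.isZmodMorphism.Build (lattice d) (lattice d * lattice d)%type inl0 inl0_zmod_morphism.
HB.instance Definition _ :=
  GRing.isZmodMorphism.Build (lattice d) (lattice d * lattice d)%type inr0 inr0_zmod_morphism.

End SupNorm.

Lemma prod_three_blocks (A : comNzRingType) (x y z : A) (N m k : nat) : (m + k <= N)%N ->
  \prod_(i < N) (if (i < m)%N then x else if (i < m + k)%N then y else z) =
  x ^+ m * y ^+ k * z ^+ (N - (m + k)).
Proof.
move=> mkN.
rewrite -(big_mkord xpredT (fun i => if (i < m)%N then x else if (i < m + k)%N then y else z)).
rewrite (@big_cat_nat _ _ _ m)//=; last by lia.
rewrite (@big_cat_nat _ _ _ (m + k) m)//= ?mulrA; last by lia.
congr (_ * _ * _).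
- rewrite (eq_big_nat _ _ (F2 := fun=> x)) ?prodr_const_nat ?subn0// => i /andP[_ ->]//.
- rewrite (eq_big_nat _ _ (F2 := fun=> y)) ?prodr_const_nat ?addKn// => i /andP[mi ->].
  by rewrite ltnNge mi.
- rewrite (eq_big_nat _ _ (F2 := fun=> z)) ?prodr_const_nat// => i /andP[mi _].
  by rewrite [(i < m + k)%N]ltnNge mi ltnNge (leq_trans (leq_addr _ _) mi).
Qed.

Section Correlations.
Context (R : realType) (V : finType) (p : V -> R).
Context (p_ge0 : forall v, 0 <= p v) (p_le1 : \sum_v p v <= 1).
Context (d : nat) (step : V -> lattice d).

(** The length [N] is fixed while the time [m] varies, so the walk at all times lives on one finite
    weighted space. *)
Definition word_walk N (w : {ffun 'I_N -> V}) (m : nat) : lattice d :=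
  \sum_(i < N | (i < m)%N) step (w i).

Let diag_op : shift_op R (lattice d * lattice d)%type := step_op p (fun v => (step v, step v)).
Let second_op : shift_op R (lattice d * lattice d)%type := step_op p (fun v => (0, step v)).
(* Steps drawn after the times of interest move nothing, but the mass of a
   truncated step may be less than 1, so they still contribute a factor. *)
Let idle_op : shift_op R (lattice d * lattice d)%type := step_op p (fun=> 0).

(** The two positions form one walk on the square of the lattice: the first [m] steps move both
    coordinates, the next [k] only the second, the others neither. *)
Lemma sum_word_walk_pair N m k (Phi : lattice d * lattice d -> R) : (m + k <= N)%N ->
  \sum_(w : {ffun 'I_N -> V}) word_weight p w * Phi (word_walk w m, word_walk w (m + k)) =
  (diag_op ^+ m * second_op ^+ k * idle_op ^+ (N - (m + k))) Phi 0.
Proof.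
move=> mkN; rewrite -prod_three_blocks//.
pose phi (i : 'I_N) v : lattice d * lattice d :=
  (if (i < m)%N then step v else 0, if (i < m + k)%N then step v else 0).
rewrite (eq_bigr (fun i => step_op p (phi i))); last first.
  move=> i _; rewrite /phi; case: ltnP => im; last by case: ltnP.
  by rewrite (leq_trans im (leq_addr _ _)).
rewrite prod_step_op shift_op_sumE; apply: eq_bigr => w _; rewrite tauE add0r.
congr (_ * Phi _).
rewrite [RHS]surjective_pairing /word_walk.
by congr (_, _); rewrite big_mkcond raddf_sum.
Qed.

Context (C : R).
Context (smooth : forall j : 'I_d, exists (n : nat) (w1 w2 : {ffun 'I_n -> V}) (h : R),
  [/\ 0 < h, h <= word_weight p w1, h <= word_weight p w2,
      \sum_i step (w2 i) - \sum_i step (w1 i) = unit_vec j & 2 * n%:R / h <= C]).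

(** [psi] will be [dup] for the steps before the earlier time and [inr0] for those between the two
    times. *)
Lemma smooth_step_op (G : zmodType) (psi : {additive lattice d -> G}) (l : nat) j :
  shift_bnd (step_op p (psi \o step) ^+ l) (psi (unit_vec j)) (Num.sqrt (C / l.+1%:R)).
Proof.
have [n [w1 [w2 [h [h0 h1 h2 ej hC]]]]] := smooth j.
have w12 : w1 != w2.
  apply/eqP => E; move: ej; rewrite E subrr => /matrixP/(_ ord0 j)/eqP.
  by rewrite !mxE !eqxx eq_sym oner_eq0.
have := step_op_smoothing p_ge0 p_le1 (psi \o step) l h0 h1 h2 w12.
rewrite /= -!raddf_sum -raddfB ej => hs; apply: bndW hs _.
by rewrite ler_wsqrtr// ler_wpM2r.
Qed.

(** Cutting [r] blocks [K] out of the kernel of the pair provides the smoothing that replaces [F] by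
    its cube averages at both times. Each block takes [l] steps before the earlier time and [l]
    steps between the two. *)
Lemma correlation_bound (F : lattice d -> R) (M delta : R) (B N m k l r n : nat) :
  (forall v, (sup_norm (step v) <= B)%N) ->
  (forall x, `|F x| <= M) -> 0 <= delta ->
  (forall x, (sup_norm x <= N * B + 2 * (r * n))%N -> `|cube_average F n x| <= delta) ->
  (r * l <= m)%N -> (r * l <= k)%N -> (m + k <= N)%N ->
  `|\sum_(w : {ffun 'I_N -> V}) word_weight p w *
      (F (word_walk w m) * F (word_walk w (m + k)))|
  <= 4 ^+ r * delta ^+ 2 +
     2 ^+ r.+1 * (2 * (d * n)%:R * Num.sqrt (C / l.+1%:R)) ^+ r * M ^+ 2.
Proof.
move=> stepB FM d0 hd rm rk mkN.
have M0 : 0 <= M by exact: le_trans (normr_ge0 _) (FM 0).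
pose Phi (x : lattice d * lattice d) := F x.1 * F x.2.
rewrite (@sum_word_walk_pair N m k Phi mkN).
pose K := diag_op ^+ l * second_op ^+ l.
pose kappa := diag_op ^+ (m - r * l) * second_op ^+ (k - r * l) * idle_op ^+ (N - (m + k)).
have -> : diag_op ^+ m * second_op ^+ k * idle_op ^+ (N - (m + k)) = kappa * K ^+ r.
  rewrite /kappa /K exprMn -!exprM -{1}(subnK rm) -{1}(subnK rk) !exprD (mulnC l).
  move: (diag_op ^+ _) (diag_op ^+ _) (second_op ^+ _) (second_op ^+ _) (idle_op ^+ _) => *.
  by ring.
pose s := Num.sqrt (C / l.+1%:R).
pose y1 (y : {ffun 'I_d -> 'I_n.+1}) : lattice d * lattice d := inl0 (cube_point y).
pose y2 (y : {ffun 'I_d -> 'I_n.+1}) : lattice d * lattice d := inr0 (cube_point y).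
have bX phi i : bnd (step_op p phi ^+ i : shift_op R (lattice d * lattice d)%type) 1.
  by rewrite -(expr1n R i); apply: bndX; exact: bnd_step_op.
have I0 : (0 < #|{ffun 'I_d -> 'I_n.+1}|)%N by rewrite card_ffun !card_ord expn_gt0.
(* A point of the cube is reached by at most [d * n] unit shifts, each of cost at most [2 * s]. *)
have eta_le (y : {ffun 'I_d -> 'I_n.+1}) c : 0 <= c -> c <= 2 * s ->
    \sum_j c *+ y j <= 2 * (d * n)%:R * s.
  move=> c0 cs; apply: (@le_trans _ _ (\sum_(j < d) c *+ n)).
    by apply: ler_sum => j _; apply: ler_wpMn2l => //; exact: leq_ord.
  rewrite sumr_const card_ord -mulrnA mulnC mulrAC -[X in X <= _]mulr_natr.
  by rewrite ler_wpM2r.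
have s0 : 0 <= s by exact: sqrtr_ge0.
have sd j : shift_bnd K (dup (unit_vec j)) s.
  apply: shift_bndM; [exact: (smooth_step_op (@dup d))|exact: bX].
have s2 j : shift_bnd K (inr0 (unit_vec j)) s.
  rewrite /K mulrC; apply: shift_bndM; [exact: (smooth_step_op (@inr0 d))|exact: bX].
(* A shift of the first coordinate alone is a common shift followed by a backward shift of the
   second, whence the factor 2. *)
have s1 j : shift_bnd K (inl0 (unit_vec j)) (2 * s).
  have -> : inl0 (unit_vec j) = dup (unit_vec j) + - inr0 (unit_vec j).
    by apply/eqP; rewrite xpair_eqE /= subr0 subrr !eqxx.
  rewrite mulr_natl mulr2n; apply: shift_bndD => //; exact: shift_bndN.
have u1u2E (x : lattice d * lattice d) : (average_op R y1 * average_op R y2) Phi x =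
    cube_average F n x.1 * cube_average F n x.2.
  rewrite shift_op_mulE shift_op_sumE /cube_average -mulrA mulr_suml mulr_sumr.
  apply: eq_bigr => a _; rewrite tauE shift_op_sumE; congr (_ * _).
  rewrite [RHS]mulrCA !mulr_sumr; apply: eq_bigr => b _.
  by rewrite tauE /Phi /= !addr0.
have Brange phi i : (forall v, (pair_norm (phi v) <= B)%N) ->
    in_range (@pair_norm d) (step_op p phi ^+ i : shift_op R (lattice d * lattice d)%type) (i * B).
  move=> hphi; apply: (in_rangeX (@pair_norm0 d) (@pair_normD d)).
  by apply: in_range_sum => v; exact: in_range_tau.
have stepB' v : (pair_norm (step v, step v) <= B)%N by rewrite /pair_norm geq_max /= !stepB.
have stepB2 v : (pair_norm (inr0 (step v)) <= B)%N by rewrite /pair_norm geq_max /= sup_norm0 stepB.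
apply: (two_average_bound (@pair_norm0 d) (@pair_normD d)
  (u1 := average_op R y1) (u2 := average_op R y2)
  (k1 := (m - r * l) * B + (k - r * l) * B) (k2 := l * B + l * B) (k3 := n)).
- rewrite -[1]mul1r; apply: bndM; last exact: bX.
  by rewrite -[1]mul1r; apply: bndM; exact: bX.
- by rewrite -[1]mul1r; apply: bndM; exact: bX.
- exact: bnd_average_op.
- exact: bnd_average_op.
- apply: bnd_one_sub_average_op => // y.
  have -> : y1 y = \sum_j inl0 (unit_vec j) *+ y j.
    by rewrite /y1 cube_point_sum raddf_sum; apply: eq_bigr => j _; rewrite raddfMn.
  apply: bndW; first by apply: shift_bnd_sum => j; apply: shift_bndMn; exact: s1.
  by apply: eta_le; rewrite // mulr_ge0.
- apply: bnd_one_sub_average_op => // y.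
  have -> : y2 y = \sum_j inr0 (unit_vec j) *+ y j.
    by rewrite /y2 cube_point_sum raddf_sum; apply: eq_bigr => j _; rewrite raddfMn.
  apply: bndW; first by apply: shift_bnd_sum => j; apply: shift_bndMn; exact: s2.
  by apply: eta_le => //; rewrite mulr_natl mulr2n lerDl.
- rewrite -[((m - r * l) * B + (k - r * l) * B)%N]addn0.
  apply: (in_rangeM (@pair_normD d)).
    by apply: (in_rangeM (@pair_normD d)); exact: Brange.
  rewrite -(muln0 (N - (m + k))%N); apply: (in_rangeX (@pair_norm0 d) (@pair_normD d)).
  by apply: in_range_sum => v; apply: in_range_tau; rewrite pair_norm0.
- by apply: (in_rangeM (@pair_normD d)); exact: Brange.
- apply: in_range_sum => y; apply: in_range_tau.
  by rewrite /pair_norm geq_max /= sup_norm0 sup_norm_cube_point.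
- apply: in_range_sum => y; apply: in_range_tau.
  by rewrite /pair_norm geq_max /= sup_norm0 sup_norm_cube_point.
- by move=> y; rewrite normrM expr2 ler_pM.
- exact: sqr_ge0.
- move=> v hv; rewrite u1u2E normrM expr2.
  (* The ranges of [kappa] and of the [r] blocks add up to that of [m + k] steps of size at most
     [B]. *)
  have hN : ((m - r * l) * B + (k - r * l) * B + r * (l * B + l * B) <= N * B)%N.
    apply: leq_trans (_ : (m + k) * B <= _)%N; last by rewrite leq_mul2r mkN orbT.
    rewrite -{2}(subnK rm) -{2}(subnK rk) !mulnDl mulnDr !mulnA; lia.
  have := leq_trans hv (leq_add hN (leqnn _)); rewrite /pair_norm geq_max => /andP[h1 h2].
  by rewrite ler_pM// hd.
Qed.

End Correlations.

(** * The Rademacher--Menshov maximal inequality *)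

Section Chaining.
Context (R : realType).
Implicit Types (T : nat -> R).

(** The sum of the squared increments of [T] over all dyadic subintervals of [[a, a + 2^j]], on all
    levels. *)
Fixpoint dyadic_squares T (j a : nat) : R :=
  if j is j'.+1 then
    (T (a + 2 ^ j)%N - T a) ^+ 2 + dyadic_squares T j' a
      + dyadic_squares T j' (a + 2 ^ j')%N
  else (T a.+1 - T a) ^+ 2.

Lemma dyadic_squares_ge0 T j a : 0 <= dyadic_squares T j a.
Proof. by elim: j a => [|j IH] a /=; rewrite ?addr_ge0// sqr_ge0. Qed.

Lemma dyadic_squares_ge T j a : (T (a + 2 ^ j)%N - T a) ^+ 2 <= dyadic_squares T j a.
Proof.
case: j => [|j] /=; first by rewrite expn0 addn1.
by rewrite -addrA lerDl addr_ge0// dyadic_squares_ge0.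
Qed.

(* The step from [j] to [j + 1] is the weighted Cauchy-Schwarz inequality
   [(x + y)^2 <= (j + 2) (x^2 + y^2 / (j + 1))]. *)
Lemma dyadic_squares_max T j a n : (n <= 2 ^ j)%N ->
  (T (a + n)%N - T a) ^+ 2 <= j.+1%:R * dyadic_squares T j a.
Proof.
elim: j a n => [|j IH] a n nj.
  rewrite mul1r; case: n nj => [|[|//]] _ /=; last by rewrite addn1.
  by rewrite addn0 subrr expr0n sqr_ge0.
have [nle|ngt] := leqP n (2 ^ j).
  apply: le_trans (IH a n nle) _; apply: ler_pM => //=.
  - exact: dyadic_squares_ge0.
  - by rewrite ler_nat.
  - by rewrite addrAC lerDr addr_ge0// ?sqr_ge0// dyadic_squares_ge0.
(* Past the midpoint, the increment is that of the whole left half plus one inside the right half,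
   to which the induction hypothesis applies. *)
have nsub : (n - 2 ^ j <= 2 ^ j)%N by move: nj; rewrite expnS mul2n -addnn; lia.
have := IH (a + 2 ^ j)%N _ nsub; rewrite -addnA (subnKC (ltnW ngt)) => hy.
have hx := dyadic_squares_ge T j a.
have h2 : 0 <= (T (a + 2 ^ j.+1)%N - T a) ^+ 2 by exact: sqr_ge0.
rewrite /=; move: (dyadic_squares T j (a + 2 ^ j)%N) (dyadic_squares T j a) hx hy => D' D hx hy.
set x := T (a + 2 ^ j)%N - T a in hx; set y := T (a + n)%N - _ in hy.
have -> : T (a + n)%N - T a = x + y by rewrite /x /y [RHS]addrC addrA subrK.
have j0 : 0 < j.+1%:R :> R by rewrite ltr0n.
apply: (@le_trans _ _ (j.+2%:R * (D + D'))); last first.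
  by rewrite ler_wpM2l// -addrA lerDr.
rewrite -(ler_pM2l j0) -subr_ge0.
have hyx : 0 <= (j.+1%:R * x - y) ^+ 2 by exact: sqr_ge0.
have hD' : 0 <= j.+1%:R * D' - y ^+ 2 by rewrite subr_ge0.
have hD : 0 <= D - x ^+ 2 by rewrite subr_ge0.
rewrite -[j.+2%:R]natr1; move: j0 hyx hD' hD; set k := j.+1%:R => j0 hyx hD' hD.
(* After multiplication by [k = j + 1] the slack is a sum of three nonnegative terms. *)
have -> : k * ((k + 1) * (D + D')) - k * (x + y) ^+ 2 =
  (k + 1) * k * (D - x ^+ 2) + (k + 1) * (k * D' - y ^+ 2) + (k * x - y) ^+ 2 by ring.
have k10 : 0 <= k + 1 by rewrite addr_ge0// ltW.
by rewrite !addr_ge0// !mulr_ge0// ltW.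
Qed.

(** Doubling the range adds [2 ^ j] terms, each at most the inverse of [2 ^ j]. *)
Lemma harmonic_pow2_le j : \sum_(i < 2 ^ j) (i.+1%:R^-1 : R) <= j.+1%:R.
Proof.
elim: j => [|j IH]; first by rewrite expn0 big_ord1 invr1.
rewrite expnS mul2n -addnn big_split_ord/= -[j.+2%:R]natr1; apply: lerD => //.
apply: (@le_trans _ _ (\sum_(i < 2 ^ j) (2 ^ j)%:R^-1)).
  apply: ler_sum => i _; rewrite lef_pV2 ?posrE ?ltr0n ?expn_gt0// ler_nat.
  by rewrite -addnS leq_addr.
by rewrite sumr_const card_ord -[_ *+ _]mulr_natr mulVf// pnatr_eq0 -lt0n expn_gt0.
Qed.

End Chaining.

Section MaximalInequality.
Context (R : realType) (V : finType) (p : V -> R).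
Context (p_ge0 : forall v, 0 <= p v).
Context (d : nat) (step : V -> lattice d) (F : lattice d -> R).

Definition word_functional N (w : {ffun 'I_N -> V}) (n : nat) : R :=
  \sum_(1 <= i < n.+1) F (word_walk step w i).

Let E N (f : {ffun 'I_N -> V} -> R) : R := \sum_w word_weight p w * f w.

(** Passing from [K] to [K + 1] adds one square, at most [Q], and twice the correlations of the new
    term with the [K] old ones, which sum to at most [2 * Q * H]. Since [H >= 1], the total is at
    most [5 * Q * H]. *)
Lemma word_second_moment N (Q H : R) (a K : nat) :
  (forall m k l, (l <= m)%N -> (l <= k)%N -> (m + k <= N)%N ->
    `|E (fun w : {ffun 'I_N -> V} => F (word_walk step w m) * F (word_walk step w (m + k)))|
      <= Q / l.+1%:R) ->
  1 <= H -> \sum_(i < N) i.+1%:R^-1 <= H -> (a + K <= N)%N ->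
  E (fun w : {ffun 'I_N -> V} => (word_functional w (a + K) - word_functional w a) ^+ 2)
    <= K%:R * (5 * Q * H).
Proof.
move=> hQ H1 hH; elim: K => [|K IH] aK.
  rewrite mul0r addn0 /E big1// => w _.
  by rewrite subrr expr0n mulr0.
have Q0 : 0 <= Q.
  have := hQ 0%N 0%N 0%N (leqnn _) (leqnn _) (leq0n _); rewrite divr1.
  exact: le_trans.
pose f (w : {ffun 'I_N -> V}) i := F (word_walk step w (a + i).+1).
have TE w (n : nat) : word_functional w (a + n) - word_functional w a = \sum_(i < n) f w i.
  rewrite /word_functional (@big_cat_nat _ _ _ a.+1) ?ltnS ?leq_addr//=.
  rewrite addrAC subrr add0r.
  rewrite -addSn -{1}[a.+1]add0n big_addn addKn big_mkord.
  by apply: eq_bigr => i _; rewrite /f addnC addSn.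
have -> : E (fun w : {ffun 'I_N -> V} =>
      (word_functional w (a + K.+1) - word_functional w a) ^+ 2) =
    E (fun w : {ffun 'I_N -> V} => (word_functional w (a + K) - word_functional w a) ^+ 2) +
    2 * (\sum_(i < K) E (fun w : {ffun 'I_N -> V} => f w i * f w K)) +
    E (fun w : {ffun 'I_N -> V} => f w K * f w K).
  rewrite mulr_sumr /E; under [\sum_(i < K) _]eq_bigr do rewrite mulr_sumr.
  rewrite exchange_big -!big_split/=; apply: eq_bigr => w _.
  rewrite !TE big_ord_recr/=.
  have -> : \sum_(i < K) 2 * (word_weight p w * (f w i * f w K)) =
      2 * word_weight p w * f w K * \sum_(i < K) f w i.
    by rewrite mulr_sumr; apply: eq_bigr => i _; ring.
  ring.
have c0 : E (fun w : {ffun 'I_N -> V} => f w K * f w K) <= Q.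
  have := hQ (a + K).+1 0%N 0%N (leq0n _) (leqnn _); rewrite !addn0 divr1 => h.
  by apply: le_trans (ler_norm _) (h _); rewrite -addnS.
have cs : \sum_(i < K) E (fun w : {ffun 'I_N -> V} => f w i * f w K) <= 2 * Q * H.
  have KN : (K <= N)%N by lia.
  have hK : \sum_(i < K) i.+1%:R^-1 <= H.
    apply: le_trans hH; rewrite (big_ord_widen N (fun i => i.+1%:R^-1) KN).
    rewrite [X in _ <= X](bigID (fun i : 'I_N => (i < K)%N))/= lerDl.
    by apply: sumr_ge0 => i _; rewrite invr_ge0.
  (* The hypothesis needs [l] below both the earlier time and the lag, so [l] is the smaller of [i]
     and [K - i]; the sum of both bounds covers either case. *)
  apply: (@le_trans _ _ (\sum_(i < K) (Q / i.+1%:R + Q / (K - i).+1%:R))).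
    apply: ler_sum => i _; apply: le_trans (ler_norm _) _.
    have iK := ltn_ord i.
    have E1 : (a + K).+1 = ((a + i).+1 + (K - i))%N by lia.
    rewrite /f E1.
    have h1 : 0 <= Q / i.+1%:R by rewrite divr_ge0.
    have h2 : 0 <= Q / (K - i).+1%:R by rewrite divr_ge0.
    have aiK : ((a + i).+1 + (K - i) <= N)%N by lia.
    have [iKi|Kii] := leqP i (K - i).
      apply: le_trans (hQ _ _ i _ _ aiK) _ => //; last by rewrite lerDl.
      by rewrite leqW// leq_addl.
    apply: le_trans (hQ _ _ (K - i)%N _ _ aiK) _ => //; last by rewrite lerDr.
    by rewrite leqW// (leq_trans (ltnW Kii))// leq_addl.
  rewrite big_split/= -!mulr_sumr mulr_natl mulr2n mulrDl; apply: lerD.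
    by rewrite ler_wpM2l.
  rewrite ler_wpM2l//; apply: le_trans hK.
  rewrite (reindex_inj rev_ord_inj)/=; apply: ler_sum => i _.
  rewrite lef_pV2 ?posrE ?ltr0n// ler_nat; have := ltn_ord i; lia.
have aK' : (a + K <= N)%N by lia.
have IH' := IH aK'; rewrite -[K.+1%:R]natr1 [X in _ <= X]mulrDl mul1r.
have QH : Q <= Q * H by rewrite ler_peMr.
rewrite -addrA; apply: lerD => //.
by move: cs c0 QH; lra.
Qed.

(** The blocks of one level have total length [2 ^ j], so each of the [j + 1] levels contributes at
    most [2 ^ j] times [U]. *)
Lemma word_dyadic_squares N (U : R) (j a : nat) :
  (forall a K, (a + K <= N)%N ->
    E (fun w : {ffun 'I_N -> V} => (word_functional w (a + K) - word_functional w a) ^+ 2)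
      <= K%:R * U) ->
  (a + 2 ^ j <= N)%N ->
  E (fun w : {ffun 'I_N -> V} => dyadic_squares (word_functional w) j a)
    <= j.+1%:R * (2 ^ j)%:R * U.
Proof.
move=> h; elim: j a => [|j IH] a haN /=.
  rewrite -[a.+1]addn1; by rewrite expn0 mulr1; exact: h.
have -> : E (fun w : {ffun 'I_N -> V} =>
   (word_functional w (a + 2 ^ j.+1) - word_functional w a) ^+ 2 +
   dyadic_squares (word_functional w) j a + dyadic_squares (word_functional w) j (a + 2 ^ j)) =
   E (fun w : {ffun 'I_N -> V} => (word_functional w (a + 2 ^ j.+1) - word_functional w a) ^+ 2) +
   E (fun w : {ffun 'I_N -> V} => dyadic_squares (word_functional w) j a) +
   E (fun w : {ffun 'I_N -> V} => dyadic_squares (word_functional w) j (a + 2 ^ j)).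
  by rewrite /E -!big_split/=; apply: eq_bigr => w _; rewrite !mulrDr.
have e2 : (2 ^ j.+1 = 2 ^ j + 2 ^ j)%N by rewrite expnS mul2n addnn.
have h1 : (a + 2 ^ j <= N)%N by lia.
have h2 : (a + 2 ^ j + 2 ^ j <= N)%N by lia.
apply: le_trans (lerD (lerD (h _ _ haN) (IH _ h1)) (IH _ h2)) _.
by rewrite e2 natrD -[j.+2%:R]natr1; rewrite le_eqVlt; apply/orP; left; apply/eqP; ring.
Qed.

(** Chebyshev's inequality for the dyadic sum of squares, which controls all times at once. The
    three factors [j + 1] come from the chaining, the number of levels and the harmonic sum. *)
Lemma word_maximal_inequality j (Q lam : R) : 0 < lam ->
  (forall m k l, (l <= m)%N -> (l <= k)%N -> (m + k <= 2 ^ j)%N ->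
    `|E (fun w : {ffun 'I_(2 ^ j) -> V} =>
          F (word_walk step w m) * F (word_walk step w (m + k)))| <= Q / l.+1%:R) ->
  \sum_(w : {ffun 'I_(2 ^ j) -> V} |
        [exists n : 'I_(2 ^ j).+1, lam < `|word_functional w n|]) word_weight p w
    <= 5 * j.+1%:R ^+ 3 * (2 ^ j)%:R * Q / lam ^+ 2.
Proof.
move=> lam0 hQ.
have H1 : 1 <= j.+1%:R :> R by rewrite ler1n.
have hU a K := @word_second_moment _ Q j.+1%:R a K hQ H1 (harmonic_pow2_le R j).
have := word_dyadic_squares (j := j) (a := 0) hU; rewrite add0n => /(_ (leqnn _)) hD.
rewrite ler_pdivlMr ?exprn_gt0//.
apply: (@le_trans _ _ (j.+1%:R * E (fun w : {ffun 'I_(2 ^ j) -> V} =>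
    dyadic_squares (word_functional w) j 0))); last first.
  apply: le_trans (ler_wpM2l _ hD) _ => //.
  by rewrite le_eqVlt; apply/orP; left; apply/eqP; ring.
rewrite mulr_suml mulr_sumr big_mkcond; apply: ler_sum => w _.
have w0 := word_weight_ge0 p_ge0 w.
case: ifPn => [/existsP[n hn]|_]; last by rewrite !mulr_ge0// dyadic_squares_ge0.
rewrite [X in _ <= X]mulrCA ler_wpM2l//.
apply: le_trans (dyadic_squares_max (word_functional w) 0 (leq_ord n)).
rewrite add0n [word_functional w 0]/word_functional big_geq// subr0.
by rewrite -[X in _ <= X]real_normK ?num_real// lerXn2r// ?nnegrE ltW.
Qed.

End MaximalInequality.

(** * Differences of words *)

Section WordDifferences.
Context (G : zmodType) (S : set G).

Definition word_in (s : seq G) : Prop := forall v, v \in s -> S v.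

(** These are the pairs [(t, x)] with [t >= 0] in the subgroup of [Z x G] generated by the [(1, v)]
    with [v] in [S]. *)
Definition word_difference (t : nat) (x : G) : Prop := exists u w : seq G,
  [/\ word_in u, word_in w, size u = (size w + t)%N &
      \sum_(v <- u) v = \sum_(v <- w) v + x].

Lemma word_in_cat u w : word_in u -> word_in w -> word_in (u ++ w).
Proof. by move=> hu hw v; rewrite mem_cat => /orP[/hu|/hw]. Qed.

Lemma word_difference_word s : word_in s -> word_difference (size s) (\sum_(v <- s) v).
Proof. by move=> hs; exists s, [::]; split=> //; rewrite big_nil add0r. Qed.

Lemma word_difference0 : word_difference 0 0.
Proof. by exists [::], [::]; rewrite big_nil addr0. Qed.

Lemma word_differenceD t t' x x' :
  word_difference t x -> word_difference t' x' -> word_difference (t + t') (x + x').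
Proof.
move=> [u [w [hu hw st sx]]] [u' [w' [hu' hw' st' sx']]].
exists (u ++ u'), (w ++ w'); split; [exact: word_in_cat|exact: word_in_cat| |].
  by rewrite !size_cat st st' addnACA.
by rewrite !big_cat /= sx sx' addrACA.
Qed.

Lemma word_differenceB t t' x x' : (t' <= t)%N ->
  word_difference t x -> word_difference t' x' -> word_difference (t - t') (x - x').
Proof.
move=> tt' [u [w [hu hw st sx]]] [u' [w' [hu' hw' st' sx']]].
exists (u ++ w'), (w ++ u'); split; [exact: word_in_cat|exact: word_in_cat| |].
  by rewrite !size_cat st st'; lia.
by rewrite !big_cat /= sx sx' [x - x']addrC !addrA addrK addrAC.
Qed.

(** The least positive [t] with [word_difference t 0] divides all the others by Euclidean division,
    so the gcd condition makes it 1. Subtracting [(1, 0)] from [(1, v)] then gives every generator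
    [v] at length 0. *)
Lemma word_difference_generated x :
  smallest (fun H : set G => H 0 /\ forall x y, H x -> H y -> H (x - y)) S x ->
  (forall m, (forall n, (0 < n)%N -> word_difference n 0 -> (m %| n)%N) -> (m %| 1)%N) ->
  word_difference 0 x.
Proof.
move=> Sx hgcd.
have [n0 [n00 hn0]] : exists n, (0 < n)%N /\ word_difference n 0.
  (* Without such an [n], the divisibility hypothesis would apply vacuously to [m = 2]. *)
  apply: contrapT => hn; suff : (2 %| 1)%N by [].
  by apply: hgcd => n n0 hn'; exfalso; apply: hn; exists n.
have ex : exists n, (fun n => `[< (0 < n)%N /\ word_difference n 0 >]) n.
  by exists n0; apply/asboolP.
case: (ex_minnP ex) => t0 /asboolP[t00 ht0] tmin.
have hq q : word_difference (q * t0) 0.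
  elim: q => [|q IH]; first exact: word_difference0.
  by rewrite mulSn -[0]addr0; exact: word_differenceD.
have t01 : t0 = 1%N.
  apply/eqP; rewrite -dvdn1; apply: hgcd => n n_gt0 hn.
  rewrite /dvdn; apply: contraT; rewrite -lt0n => r0.
  have : word_difference (n - n %/ t0 * t0) (0 - 0).
    by apply: word_differenceB => //; exact: leq_trunc_div.
  rewrite subr0 {1}(divn_eq n t0) addKn => hr.
  suff : (t0 <= n %% t0)%N by rewrite leqNgt ltn_mod t00.
  by apply: tmin; apply/asboolP.
move: ht0; rewrite t01 => h10.
apply: Sx; split; last first.
  move=> v Sv; have := @word_difference_word [:: v].
  rewrite big_seq1 /= => /(_ _); rewrite -[v in word_difference 0 v]subr0 => h.
  have := @word_differenceB 1 1 v 0 (leqnn _) (h _) h10; rewrite subnn; apply.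
  by move=> y; rewrite inE => /eqP->.
split; first exact: word_difference0.
by move=> y z hy hz; have := word_differenceB (leqnn 0) hy hz.
Qed.

End WordDifferences.

(** * Truncating the walk to a box *)

Section Probability.
Context (R : realType) (d0 : measure_display) (Omega : measurableType d0).
Context (P : probability Omega R) (d : nat) (X : nat -> {RV P >-> lattice d}).
Context (hind : mutually_independent X) (hid : identically_distributed X).

Definition step_prob (v : lattice d) : R := fine (P (X 0%N @^-1` [set v])).

Lemma measurable_step n (A : set (lattice d)) : measurable (X n @^-1` A).
Proof. exact: measurable_funPTI. Qed.
Hint Resolve measurable_step : core.

Lemma step_prob_ge0 v : 0 <= step_prob v.
Proof. by rewrite fine_ge0. Qed.

Lemma prob_step n A : P (X n @^-1` A) = P (X 0%N @^-1` A).
Proof. exact: hid. Qed.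

Lemma prob_step1 n v : P (X n @^-1` [set v]) = (step_prob v)%:E.
Proof. by rewrite prob_step /step_prob fineK// fin_num_measure. Qed.

Lemma sum_step_prob_le1 (s : seq (lattice d)) :
  uniq s -> \sum_(v <- s) step_prob v <= 1.
Proof.
move=> us; rewrite -lee_fin -sumEFin.
suff -> : (\sum_(v <- s) (step_prob v)%:E)%E = P (X 0%N @^-1` [set` s]).
  exact: probability_le1.
elim: s us => [|v s IH] /=; first by rewrite big_nil set_nil preimage_set0 measure0.
move=> /andP[vs us]; have -> : [set` v :: s] = [set v] `|` [set` s].
  by apply/seteqP; split=> x /=; rewrite inE;
    [by move=> /orP[/eqP->|]; [left|right]|by move=> [->|->]; rewrite ?eqxx ?orbT].
rewrite big_cons preimage_setU measureU//.
  by rewrite -(prob_step1 0); congr (_ + _)%E; exact: IH.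
rewrite -subset0 => w [/= -> ]; by rewrite (negPf vs).
Qed.

Definition cylinder N (v : 'I_N -> lattice d) : set Omega :=
  [set w | forall i : 'I_N, X i w = v i].

Definition segment (N : nat) : {fset nat} := [fset i in iota 0 N]%fset.

Lemma in_segment N i : (i \in segment N) = (i < N)%N.
Proof. by rewrite inE /= mem_iota add0n. Qed.

Lemma cylinderE N (v : nat -> lattice d) :
  cylinder (fun i : 'I_N => v i) =
  \bigcap_(i in [set` segment N]) (X i @^-1` [set v i]).
Proof.
apply/seteqP; split=> w /= h.
  by move=> i /=; rewrite in_segment => iN; exact: (h (Ordinal iN)).
by move=> i; apply: (h i); rewrite /= in_segment ltn_ord.
Qed.

(** Independence is stated for families of events indexed by all of [nat], so a finite word is
    extended by 0. *)
Lemma ord_fun_nat N (v : 'I_N -> lattice d) :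
  exists v' : nat -> lattice d, v = (fun i : 'I_N => v' i).
Proof.
exists (fun i => if insub i is Some j then v j else 0).
by apply/funext => i; rewrite valK.
Qed.

Lemma measurable_cylinder N (v : 'I_N -> lattice d) : measurable (cylinder v).
Proof.
have [v' ->] := ord_fun_nat v; rewrite cylinderE.
apply: fin_bigcap_measurable => //; exact: finite_fset.
Qed.

Lemma prob_cylinder N (v : 'I_N -> lattice d) :
  P (cylinder v) = (\prod_i step_prob (v i))%:E.
Proof.
have [v' ->] := ord_fun_nat v; rewrite cylinderE hind//.
rewrite (perm_big (iota 0 N)) /=; last first.
  by apply: uniq_perm; rewrite ?fset_uniq ?iota_uniq// => i; rewrite in_segment mem_iota.
under eq_bigr do rewrite prob_step1.
by rewrite prodEFin -{1}(subn0 N) big_mkord.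
Qed.

(** The steps in the cube of radius [B] are indexed by a [finType] so that they can serve as letters
    of words. *)
Definition box_index (B : nat) : finType := {ffun 'I_d -> 'I_(2 * B).+1}.

Definition box_point (B : nat) (y : box_index B) : lattice d :=
  \row_j ((y j)%:Z - B%:Z).

Lemma box_point_inj B : injective (@box_point B).
Proof.
move=> y z /matrixP yz; apply/ffunP => j; have := yz ord0 j.
by rewrite !mxE => /(addIr _) []; exact: val_inj.
Qed.

Lemma sup_norm_box_point B (y : box_index B) : (sup_norm (box_point y) <= B)%N.
Proof. by apply/sup_normP => j; rewrite mxE; have := ltn_ord (y j); lia. Qed.

Lemma box_pointP B x : (sup_norm x <= B)%N -> exists y : box_index B, box_point y = x.
Proof.
move=> /sup_normP xB.
exists [ffun j => inord (absz (x ord0 j + B%:Z))].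
apply/rowP => j; rewrite mxE ffunE; have := xB j.
move: (x ord0 j) => a aB.
have aB2 : (absz (a + B%:Z)%R < (2 * B).+1)%N by lia.
rewrite inordK//; lia.
Qed.

Lemma sum_box_prob_le1 B : \sum_(y : box_index B) step_prob (box_point y) <= 1.
Proof.
rewrite -(big_map (@box_point B) xpredT step_prob); apply: sum_step_prob_le1.
by rewrite map_inj_uniq ?index_enum_uniq//; exact: box_point_inj.
Qed.

Lemma prob_bigsetU_le (I : Type) (r : seq I) (A : I -> set Omega) (c : I -> R) :
  (forall i, measurable (A i)) -> (forall i, (P (A i) <= (c i)%:E)%E) ->
  (P (\big[setU/set0]_(i <- r) A i) <= (\sum_(i <- r) c i)%:E)%E.
Proof.
move=> mA hA; elim: r => [|i r IH]; first by rewrite !big_nil measure0.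
rewrite !big_cons EFinD.
have mr : measurable (\big[setU/set0]_(i <- r) A i) by exact: bigsetU_measurable.
apply: (le_trans (measureU2 P (mA i) mr)); apply: leeD; first exact: hA.
exact: IH.
Qed.

(** Markov's inequality for the [q]-th moment; sup norms are integers, so exceeding [B] means
    reaching [B + 1]. *)
Lemma step_tail (hmom : all_moments_finite X) q : exists K : R, 0 <= K /\
  forall B i, (P [set w | (B < sup_norm (X i w))%N] <= (K / B.+1%:R ^+ q)%:E)%E.
Proof.
have hE := hmom q; rewrite unlock in hE.
pose g : Omega -> R := fun w => euclidean_norm R (X 0%N w) ^+ q.
have g0 w : 0 <= g w by rewrite exprn_ge0// sqrtr_ge0.
have E0 : (0 <= \int[P]_w (g w)%:E)%E by apply: integral_ge0 => w _; rewrite lee_fin.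
have {}hE : (\int[P]_w (g w)%:E < +oo)%E by [].
exists (fine (\int[P]_w (g w)%:E)); split; first exact: fine_ge0.
have norm_le x : (sup_norm x)%:R <= euclidean_norm R x.
  rewrite /sup_norm; apply: (big_ind (fun n : nat => n%:R <= euclidean_norm R x)).
  - exact: sqrtr_ge0.
  - by move=> m n hm hn; rewrite /maxn; case: ifP.
  - move=> j _; rewrite -[X in X <= _]ger0_norm// -sqrtr_sqr ler_wsqrtr//.
    rewrite (bigD1 j)//= natr_absz intr_norm real_normK ?num_real// lerDl.
    by apply: sumr_ge0 => i _; exact: sqr_ge0.
move=> B i.
have B0 : 0 < B.+1%:R ^+ q :> R by rewrite exprn_gt0.
have := prob_step i [set x | (B < sup_norm x)%N]; rewrite /preimage/= => ->.
rewrite EFinM lee_pdivlMr// fineK ?ge0_fin_numE// muleC.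
(* Every function of a step is measurable, the lattice being discrete. *)
have mg : measurable_fun [set: Omega] (fun w => (g w)%:E : \bar R).
  move=> _ Y mY; rewrite setTI.
  exact: (measurable_step 0 [set x | Y (euclidean_norm R x ^+ q)%:E]).
have := @le_integral_comp_abse _ _ _ P setT measurableT (fun w => (g w)%:E : \bar R)
  (B.+1%:R ^+ q) id
  (@measurable_id _ _ _) (fun r r0 => r0).
move=> /(_ _ mg B0); under eq_integral do rewrite /= ger0_norm//.
move=> h; apply: le_trans (h _) => //.
apply: lee_wpmul2l; first by rewrite lee_fin ltW.
apply: le_measure; rewrite ?inE.
- exact: (measurable_step 0 [set x | (B < sup_norm x)%N]).
- rewrite setTI.
  exact: (measurable_step 0
    [set x | ((B.+1%:R ^+ q)%:E <= `|(euclidean_norm R x ^+ q)%:E|)%E]).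
- move=> w /= Bw; split=> //; rewrite lee_fin ger0_norm// lerXn2r ?nnegrE ?sqrtr_ge0//.
  by apply: le_trans (norm_le _ _); rewrite ler_nat.
Qed.

(** The passage from words to paths: [A] is the union of the cylinders of the bad words and of the
    events that one of the first [N] steps leaves the box. The constant [K] depends on neither [N]
    nor [B]. *)
Lemma word_cover (hmom : all_moments_finite X) q : exists K : R, 0 <= K /\
  forall N B (bad : pred {ffun 'I_N -> box_index B}), exists A : set Omega,
  [/\ measurable A,
      (P A <= (\sum_(w | bad w) word_weight (step_prob \o @box_point B) w
               + N%:R * (K / B.+1%:R ^+ q))%:E)%E &
      forall o, ~ A o -> exists w : {ffun 'I_N -> box_index B},
        ~~ bad w /\ forall i : 'I_N, X i o = box_point (w i)].
Proof.
have [K [K0 hK]] := step_tail hmom q; exists K; split=> // N B bad.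
pose A1 := \big[setU/set0]_(w <- enum bad) cylinder (fun i : 'I_N => box_point (w i)).
pose A2 := \big[setU/set0]_(i <- iota 0 N) [set o | (B < sup_norm (X i o))%N].
have m2 i : measurable [set o | (B < sup_norm (X i o))%N].
  exact: (measurable_step i [set x | (B < sup_norm x)%N]).
exists (A1 `|` A2); split.
- by apply: measurableU; apply: bigsetU_measurable => i _ //; exact: measurable_cylinder.
- rewrite EFinD.
  have mA1 : measurable A1.
    by apply: bigsetU_measurable => i _; exact: measurable_cylinder.
  have mA2 : measurable A2 by exact: bigsetU_measurable.
  apply: (le_trans (measureU2 P mA1 mA2)); apply: leeD.
      have -> : \sum_(w | bad w) word_weight (step_prob \o @box_point B) w =
          \sum_(w <- enum bad) word_weight (step_prob \o @box_point B) w by rewrite big_enum.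
      apply: prob_bigsetU_le => w; first exact: measurable_cylinder.
      by rewrite prob_cylinder.
    apply: le_trans (prob_bigsetU_le _ m2 (fun i => hK B i)) _.
    by rewrite big_const_seq count_predT size_iota iter_addr_0 mulr_natl.
- move=> o nA.
  have hB (i : 'I_N) : (sup_norm (X i o) <= B)%N.
    rewrite leqNgt; apply/negP => h; apply: nA; right; rewrite /A2 -bigcup_seq.
    by exists (val i); rewrite //= mem_iota add0n ltn_ord.
  have [w hw] : exists w : {ffun 'I_N -> box_index B}, forall i, box_point (w i) = X i o.
    have /choice[f hf] := fun i : 'I_N => box_pointP (hB i).
    by exists [ffun i => f i] => i; rewrite ffunE.
  exists w; split; last by move=> i; rewrite hw.
  apply/negP => bw; apply: nA; left; rewrite /A1 -bigcup_seq.
  by exists w; [rewrite /= mem_enum|move=> i; rewrite hw].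
Qed.

End Probability.

(** * Smoothing words from non-degeneracy and aperiodicity *)

Section SupportWords.
Context (R : realType) (d0 : measure_display) (Omega : measurableType d0).
Context (P : probability Omega R) (d : nat) (X : nat -> {RV P >-> lattice d}).
Context (hid : identically_distributed X).

Lemma step_rangeP v : step_range X v <-> 0 < step_prob X v.
Proof.
rewrite /step_range /step_prob /=.
have f := fin_num_measure P _ (measurable_step X 0 [set v]).
by rewrite -{1}(fineK f) lte_fin.
Qed.

(** The lattice is countable, so the points of mass 0 together carry mass 0, at each of the
    countably many times. *)
Lemma negligible_off_support :
  P.-negligible [set w | exists i, ~ step_range X (X i w)].
Proof.
pose A (i k : nat) : set Omega :=
  if (choice.unpickle k : option 'rV[int]_d) is Some v then
    X i @^-1` ([set (v : lattice d)] `\` step_range X) else set0.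
apply: (@negligibleS _ _ _ _ (\bigcup_i \bigcup_k A i k)).
  move=> w [i hi]; exists i => //; exists (choice.pickle (X i w : 'rV[int]_d)) => //.
  by rewrite /A choice.pickleK.
apply: negligible_bigcup => i; apply: negligible_bigcup => k.
rewrite /A; case: choice.unpickle => [v|]; last exact: negligible_set0.
apply/negligibleP; first exact: measurable_step.
have [hv|hv] := pselect (step_range X v).
  rewrite (_ : _ @^-1` _ = set0) ?measure0//.
  by apply/seteqP; split=> // w [/= -> ].
rewrite (_ : _ `\` _ = [set (v : lattice d)]); last first.
  by apply/seteqP; split=> [w []//|w /= ->].
apply: etrans (prob_step1 hid i v) _; congr EFin; apply/eqP.
rewrite eq_le step_prob_ge0 andbT leNgt.
by apply/negP => /step_rangeP.
Qed.

(** By induction on [n], the event is a countable union over the position before the last step. *)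
Lemma measurable_walk n (v : lattice d) : measurable [set w | walk X n w = v].
Proof.
elim: n v => [|n IH] v.
  have [<-|nv] := eqVneq 0 v.
    by rewrite (_ : [set _ | _] = setT)//; apply/seteqP; split=> // w _; rewrite /= /walk big_ord0.
  rewrite (_ : [set _ | _] = set0)//; apply/seteqP; split=> // w /=.
  by rewrite /walk big_ord0 => /eqP; rewrite (negPf nv).
pose A (k : nat) : set Omega := if (choice.unpickle k : option 'rV[int]_d) is Some u then
    [set w | walk X n w = u] `&` X n @^-1` [set (v - u : lattice d)] else set0.
rewrite (_ : [set _ | _] = \bigcup_k A k).
  apply: bigcupT_measurable => k; rewrite /A; case: choice.unpickle => // u.
  by apply: measurableI; [exact: IH|exact: measurable_step].
apply/seteqP; split=> w /=; rewrite /walk big_ord_recr /= -/(walk X n w).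
  move=> e; exists (choice.pickle (walk X n w : 'rV[int]_d)) => //.
  by rewrite /A choice.pickleK -e; split=> //; rewrite /= addrAC subrr add0r.
move=> [k _]; rewrite /A; case: choice.unpickle => // u [/= -> ->].
by rewrite addrC subrK.
Qed.

(** An event of positive probability is not contained in the null set of paths with a step off the
    support, so some path returns to 0 by steps of the support only. *)
Lemma return_word n : (0 < P [set w | walk X n w = 0%R])%E ->
  word_difference (step_range X) n 0.
Proof.
move=> Pn; apply: contrapT => hn.
suff : P [set w | walk X n w = 0%R] = 0%E by move=> E; rewrite E ltxx in Pn.
apply/(negligibleP _ (measurable_walk n 0)); apply: negligibleS negligible_off_support.
move=> w /= w0; apply: contrapT => hw; apply: hn.
pose s := [seq X i w | i <- iota 0 n].
have hs : word_in (step_range X) s.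
  by move=> v /mapP[i _ ->]; apply: contrapT => hv; apply: hw; exists i.
have := word_difference_word hs.
rewrite size_map size_iota big_map.
suff -> : \sum_(i <- iota 0 n) X i w = 0 by [].
transitivity (walk X n w); last exact: w0.
by rewrite /walk -(big_mkord xpredT (fun i => X i w)) /index_iota subn0.
Qed.

Lemma unit_word_difference (hnd : nondegenerate_walk X) (hap : aperiodic_walk X) v :
  word_difference (step_range X) 0 v.
Proof.
apply: word_difference_generated; first by have := hnd; rewrite /nondegenerate_walk => ->.
(* A common divisor of the [n] with [word_difference n 0] divides all return times, whose gcd is
   1. *)
move=> m hm; have [_] := hap; apply => n [n0 Pn]; apply: hm => //.
exact: return_word.
Qed.

(** The two words of the difference have equal length and positive weight. Once the box contains
    their letters, only their encoding depends on [B], which is why [C] is uniform in [B]. *)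
Lemma smoothing_words1 (v : lattice d) : word_difference (step_range X) 0 v ->
  exists (C : R) (B0 : nat), 0 <= C /\ forall B, (B0 <= B)%N ->
  exists (n : nat) (w1 w2 : {ffun 'I_n -> box_index d B}) (h : R),
  [/\ 0 < h, h <= word_weight (step_prob X \o @box_point d B) w1,
      h <= word_weight (step_prob X \o @box_point d B) w2,
      \sum_i box_point (w2 i) - \sum_i box_point (w1 i) = v & 2 * n%:R / h <= C].
Proof.
move=> [u [w [hu hw st sx]]]; rewrite addn0 in st.
pose n := size w.
pose weight (s : seq (lattice d)) := \prod_(i < n) step_prob X (nth 0 s i).
have weight_gt0 s : size s = n -> word_in (step_range X) s -> 0 < weight s.
  move=> sn hs; apply: prodr_gt0 => i _; apply/step_rangeP/hs.
  by rewrite mem_nth// sn.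
pose h := Num.min (weight u) (weight w).
have h0 : 0 < h by rewrite lt_min !weight_gt0.
exists (2 * n%:R / h), (\max_(x <- u ++ w) sup_norm x); split.
  by rewrite divr_ge0 ?mulr_ge0// ltW.
move=> B BB.
have lift s : size s = n -> {subset s <= u ++ w} ->
    exists f : {ffun 'I_n -> box_index d B}, forall i : 'I_n, box_point (f i) = nth 0 s i.
  move=> sn suw.
  have hb (i : 'I_n) : (sup_norm (s`_i)%R <= B)%N.
    apply: leq_trans BB; apply: (leq_bigmax_seq (F := @sup_norm d)) => //.
    by apply: suw; rewrite mem_nth// sn.
  have /choice[f hf] := fun i => box_pointP (hb i).
  by exists [ffun i => f i] => i; rewrite ffunE.
have [f hf] : exists f : {ffun 'I_n -> box_index d B}, forall i : 'I_n, box_point (f i) = nth 0 w i.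
  by apply: lift => // x xw; rewrite mem_cat xw orbT.
have [g hg] : exists f : {ffun 'I_n -> box_index d B}, forall i : 'I_n, box_point (f i) = nth 0 u i.
  by apply: lift => // x xu; rewrite mem_cat xu.
have sumE s (k : {ffun 'I_n -> box_index d B}) : size s = n ->
    (forall i : 'I_n, box_point (k i) = nth 0 s i) -> \sum_i box_point (k i) = \sum_(x <- s) x.
  by move=> sn hk; rewrite (big_nth 0) sn big_mkord; apply: eq_bigr.
exists n, f, g, h; split=> //.
- by rewrite /word_weight /=; under eq_bigr do rewrite hf; rewrite ge_min lexx orbT.
- by rewrite /word_weight /=; under eq_bigr do rewrite hg; rewrite ge_min lexx.
- by rewrite (sumE u g)// (sumE w f)// sx addrC addKr.
Qed.

Lemma smoothing_words (hnd : nondegenerate_walk X) (hap : aperiodic_walk X) :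
  exists (C : R) (B0 : nat), 0 <= C /\ forall B, (B0 <= B)%N -> forall j : 'I_d,
  exists (n : nat) (w1 w2 : {ffun 'I_n -> box_index d B}) (h : R),
  [/\ 0 < h, h <= word_weight (step_prob X \o @box_point d B) w1,
      h <= word_weight (step_prob X \o @box_point d B) w2,
      \sum_i box_point (w2 i) - \sum_i box_point (w1 i) = unit_vec j & 2 * n%:R / h <= C].
Proof.
have H (j : 'I_d) := smoothing_words1 (unit_word_difference hnd hap (unit_vec j)).
have /choice[C /choice[B0 hC]] := H.
(* Sums serve as upper bounds for the maxima over [j]. *)
exists (\sum_j C j), (\sum_j B0 j)%N; split.
  by apply: sumr_ge0 => j _; have [] := hC j.
move=> B BB j; have [_ hj] := hC j.
have BjB : (B0 j <= B)%N by apply: leq_trans BB; rewrite (bigD1 j)//= leq_addr.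
have [n [w1 [w2 [h [h0 h1 h2 e hCj]]]]] := hj B BjB.
exists n, w1, w2, h; split=> //; apply: le_trans hCj _.
rewrite (bigD1 j)//= lerDl; apply: sumr_ge0 => i _; by have [] := hC i.
Qed.

End SupportWords.

(** * Cube averages *)

Section Averages.
Context (R : realType) (d : nat).

Lemma lattice_average_seq (F : lattice d -> R) (r : seq (lattice d)) : uniq r ->
  lattice_average F [set` r] = (size r)%:R^-1 * \sum_(v <- r) F v.
Proof.
move=> ur; rewrite /lattice_average mulrC -fsbig_seq//; congr (_%:R^-1 * _).
have -> : [set` r] = [set` [fset v in r]%fset].
  by apply/seteqP; split=> v /=; rewrite inE.
by rewrite set_fsetK card_fseq undup_id.
Qed.

Lemma cube_averageE (F : lattice d -> R) (n : nat) (z : lattice d) :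
  cube_average F n z = lattice_average F
    [set z + v | v in lattice_box (fun=> 0 * n%:R) (fun=> 1 * n%:R : R)].
Proof.
pose r := [seq z + cube_point y | y <- enum {ffun 'I_d -> 'I_n.+1}].
have ur : uniq r.
  rewrite map_inj_uniq ?enum_uniq// => y y' /addrI /rowP e; apply/ffunP => j.
  by have := e j; rewrite !mxE => -[] /val_inj.
suff -> : [set z + v | v in lattice_box (fun=> 0 * n%:R) (fun=> 1 * n%:R : R)] = [set` r].
  by rewrite lattice_average_seq// size_map -cardE big_map big_enum.
apply/seteqP; split=> x /=.
  move=> [v hv <-]; apply/mapP; have hj j : (0 <= v ord0 j) && (v ord0 j <= n%:Z).
    by have := hv j; rewrite mul0r mul1r ler0z -[n%:R]/(n%:Z%:~R) ler_int.
  exists [ffun j => inord (absz (v ord0 j))]; first by rewrite mem_enum.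
  congr (_ + _); apply/rowP => j; rewrite mxE ffunE.
  have := hj j; move: (v _ _) => a ha; rewrite inordK; lia.
move=> /mapP[y _ ->]; exists (cube_point y) => // j; rewrite mxE mul0r mul1r ler0n/=.
by rewrite -[n%:R]/(n%:Z%:~R) ler_int lez_nat leq_ord.
Qed.

Lemma euclidean_norm_le (x : lattice d) : euclidean_norm R x <= d%:R * (sup_norm x)%:R.
Proof.
rewrite -[X in _ <= X]ger0_norm ?mulr_ge0// -sqrtr_sqr ler_wsqrtr//.
apply: (@le_trans _ _ (\sum_(j < d) (sup_norm x)%:R ^+ 2)).
  apply: ler_sum => j _; rewrite -[X in X <= _]real_normK ?num_real// -intr_norm -natr_absz.
  by rewrite lerXn2r ?nnegrE// ler_nat; exact: (sup_normP x _ (leqnn _) j).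
rewrite sumr_const card_ord -[_ *+ d]mulr_natl exprMn ler_wpM2r ?sqr_ge0//.
by rewrite -natrX ler_nat; case: (d) => // k; rewrite -mulnn leq_pmulr.
Qed.

Lemma cube_average_bound (beta gamma : R) (F : lattice d -> R) :
  averages_near beta gamma F 0 -> exists2 C : R, 0 <= C &
  forall (n : nat) (x : lattice d), (0 < n)%N ->
    d%:R * (sup_norm x)%:R < n%:R `^ gamma ->
    `|cube_average F n x| <= C * n%:R `^ (d%:R * (beta - 1)).
Proof.
move=> hF; have [C hC] := hF (fun=> 0) (fun=> 1) (fun=> @ltr01 R).
exists `|C| => // n x n0 xn.
have V0 : lattice_box (fun _ : 'I_d => 0 * n%:R) (fun=> 1 * n%:R : R) !=set0.
  by exists (0 : lattice d) => j; rewrite mxE mul0r mul1r lexx/=.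
have := hC n%:R x _ (le_lt_trans (euclidean_norm_le x) xn) V0.
rewrite ltr0n => /(_ n0); rewrite subr0 -cube_averageE => /ltW h.
by apply: le_trans h _; rewrite ler_wpM2r ?powR_ge0// ler_norm.
Qed.

End Averages.

(** * Decay of correlations *)

Section ScaleChoice.
Context (R : realType).

Lemma gt0_powRD (x r s : R) : 0 < x -> x `^ (r + s) = x `^ r * x `^ s.
Proof. by move=> x0; apply: powRD; rewrite (gt_eqF x0) implybT. Qed.

Lemma truncn_half (y : R) : 1 <= y ->
  [/\ (0 < Num.truncn y)%N, (Num.truncn y)%:R <= y & y / 2 <= (Num.truncn y)%:R].
Proof.
move=> y1; have /andP[h1 h2] := truncn_itv (le_trans ler01 y1).
have n0 : (0 < Num.truncn y)%N.
  by rewrite lt0n; apply/eqP => e; move: h2; rewrite e ltNge y1.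
split=> //; rewrite ler_pdivrMr// mulr_natr mulr2n; apply: le_trans (ltW h2) _.
by rewrite -natr1 lerD2l ler1n.
Qed.

(* At lag [l], put [x = l + 1] and average over cubes of side
   [n ~ x ^ (1/2 - eps)]; [l' = l %/ r] is the number of steps available to
   each of the [r] smoothing factors. *)
Lemma scale_choice (d r : nat) (beta eps gamma kappa b C CF M : R) :
  0 <= beta -> beta < 1 -> 0 < eps -> eps <= 12^-1 -> 0 < gamma -> 0 <= b ->
  1 + d%:R * (beta - 1) <= b -> kappa <= b + 6 * eps ->
  1 + 2 * eps <= kappa * (2^-1 - eps) * gamma ->
  0 <= C -> 0 <= CF -> (0 < r)%N -> d%:R <= r%:R * eps ->
  exists (Q0 : R) (N0 : nat), 0 <= Q0 /\ forall N B l : nat, (N0 <= N)%N ->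
    B%:R <= N%:R `^ eps -> (2 * l <= N)%N -> N%:R `^ (b + 6 * eps) < l.+1%:R ->
    exists n l' : nat, [/\ (0 < n)%N, (r * l' <= l)%N,
      forall s, (s <= N * B + 2 * (r * n))%N -> d%:R * s%:R < n%:R `^ gamma &
      4 ^+ r * (CF * n%:R `^ (d%:R * (beta - 1))) ^+ 2 +
      2 ^+ r.+1 * (2 * (d * n)%:R * Num.sqrt (C / l'.+1%:R)) ^+ r * M ^+ 2
      <= Q0 * N%:R `^ (b + (6 + 2 * d%:R) * eps) / l.+1%:R].
Proof.
move=> beta0 beta1 eps0 eps12 gamma0 b0 hb hkappa hgamma C0 CF0 r0 hr.
have [a [aE a0 ad]] : exists a : R, [/\ d%:R * (beta - 1) = - a, 0 <= a & a <= d%:R].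
  exists (d%:R * (1 - beta)); split; first by rewrite -mulrN opprB.
    by rewrite mulr_ge0// subr_ge0 ltW.
  by rewrite ler_piMr// gerBl.
(* [D] collects the constants of the range condition; the threshold on [N] makes it smaller than
   [N ^ eps]. *)
pose D : R := d%:R * (1 + 2 * r%:R) * 2 `^ gamma.
pose K := 2 * d%:R * Num.sqrt (C * r%:R).
pose Q0 := 4 ^+ r * (CF * 2 `^ a) ^+ 2 + 2 ^+ r.+1 * K ^+ r * M ^+ 2.
have K0 : 0 <= K by rewrite !mulr_ge0// sqrtr_ge0.
have Q00 : 0 <= Q0.
  by apply: addr_ge0; rewrite mulr_ge0 ?sqr_ge0// ?mulr_ge0 ?exprn_ge0.
exists Q0, (Num.truncn (D `^ eps^-1)).+2; split=> //.
move=> N B l NN0 BN lN Nl.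
pose x : R := l.+1%:R; pose y := x `^ (2^-1 - eps).
have e2 : 0 <= 2^-1 - eps by lra.
have x0 : 0 < x by rewrite ltr0n.
have x1 : 1 <= x by rewrite ler1n.
have N0 : 0 < N%:R :> R by rewrite ltr0n (leq_trans _ NN0).
have N1 : 1 <= N%:R :> R by rewrite ler1n -(ltr0n R).
have xN : x <= N%:R.
  have N2 : (2 <= N)%N by exact: leq_trans NN0.
  by rewrite ler_nat; move: lN N2; clear; lia.
have y0 : 0 < y by exact: powR_gt0.
have y1 : 1 <= y by rewrite -(powRr0 x) ler_powR.
have yx : y <= x by rewrite ler1_powR//; lra.
have [n0 ny yn] := truncn_half y1; set n := Num.truncn y in n0 ny yn.
have D0 : 0 <= D by rewrite !mulr_ge0 ?powR_ge0// addr_ge0// mulr_ge0.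
have DN : D < N%:R `^ eps.
  have -> : D = (D `^ eps^-1) `^ eps by rewrite -powRrM mulVf ?gt_eqF// powRr1.
  rewrite gt0_ltr_powR ?nnegrE ?powR_ge0//.
  have /andP[_ h] := truncn_itv (powR_ge0 D eps^-1).
  by apply: lt_le_trans h _; rewrite ler_nat (leq_trans _ NN0).
have N1e : N%:R `^ (1 + eps) = N%:R * N%:R `^ eps.
  by rewrite gt0_powRD// powRr1// ltW.
have NeN : N%:R <= N%:R `^ (1 + eps) by rewrite le1r_powR//; lra.
exists n, (l %/ r)%N; split=> //.
- by rewrite mulnC leq_trunc_div.
- move=> s hs.
  have hs1 : s%:R <= (1 + 2 * r%:R) * N%:R `^ (1 + eps).
    apply: (@le_trans _ _ ((N * B + 2 * (r * n))%:R)); first by rewrite ler_nat.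
    rewrite natrD !natrM [X in _ <= X]mulrDl mul1r; apply: lerD; first by rewrite N1e ler_wpM2l.
    by rewrite mulrA ler_wpM2l// (le_trans ny)// (le_trans yx)// (le_trans xN).
  apply: (@le_lt_trans _ _ (d%:R * ((1 + 2 * r%:R) * N%:R `^ (1 + eps)))).
    by rewrite ler_wpM2l.
  apply: (@lt_le_trans _ _ ((y / 2) `^ gamma)); last first.
    by apply: ge0_ler_powR; rewrite ?nnegrE ?divr_ge0 ?powR_ge0// ltW.
  rewrite powRM ?powR_ge0// -powR_inv1// powRAC powR_inv1 ?powR_ge0//.
  rewrite ltr_pdivlMr ?powR_gt0//.
  have -> : d%:R * ((1 + 2 * r%:R) * N%:R `^ (1 + eps)) * 2 `^ gamma = D * N%:R `^ (1 + eps).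
    by rewrite /D; ring.
  (* One factor [N ^ eps] pays for the constants and [N ^ (1 + eps)] for the distance covered; as
     [x] exceeds [N ^ kappa], [y ^ gamma] reaches their product. *)
  apply: (@lt_le_trans _ _ (N%:R `^ eps * N%:R `^ (1 + eps))).
    by rewrite ltr_pM2r// powR_gt0.
  rewrite -gt0_powRD//.
  have -> : eps + (1 + eps) = 1 + 2 * eps by ring.
  apply: (le_trans (ler_powR N1 hgamma)).
  rewrite /y -powRrM -mulrA powRrM.
  have hq : 0 <= (2^-1 - eps) * gamma by rewrite mulr_ge0// ltW.
  apply: ge0_ler_powR; rewrite ?nnegrE ?powR_ge0//.
  by apply: (le_trans _ (ltW Nl)); exact: ler_powR.
rewrite aE.
have hd : 0 <= d%:R :> R by [].
have xpow_ge0 u : 0 <= x `^ u by exact: powR_ge0.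
(* [n] is of order [x ^ (1/2 - eps)], so the squared average is of order [x ^ (- a + 2 a eps)], and
   [a <= d]. *)
have part1 : (CF * n%:R `^ (- a)) ^+ 2 <= (CF * 2 `^ a) ^+ 2 * x `^ (- a + 2 * d%:R * eps).
  have h1 : n%:R `^ (- a) <= 2 `^ a * y `^ (- a).
    rewrite !powRN ler_pdivlMr ?powR_gt0//.
    rewrite mulrC ler_pdivrMr ?powR_gt0 ?ltr0n// -powRM//.
    apply: ge0_ler_powR; rewrite ?nnegrE ?mulr_ge0//; first exact: ltW.
    by rewrite mulrC -ler_pdivrMr.
  apply: (@le_trans _ _ ((CF * (2 `^ a * y `^ (- a))) ^+ 2)).
    by rewrite lerXn2r ?nnegrE ?mulr_ge0 ?powR_ge0// ler_wpM2l.
  rewrite mulrA [X in X <= _]exprMn ler_wpM2l ?sqr_ge0//.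
  rewrite -powR_mulrn ?powR_ge0// /y -!powRrM; apply: ler_powR => //.
  have : a * eps <= d%:R * eps by rewrite ler_wpM2r// ltW.
  by lra.
(* Moving across the cube costs [x ^ (1/2 - eps)] against a smoothing of [x ^ (- 1/2)], so each
   factor gains [x ^ (- eps)]; as [r * eps >= d >= a], the [r] factors together gain [x ^ (- a)]. *)
have part2 : (2 * (d * n)%:R * Num.sqrt (C / (l %/ r).+1%:R)) ^+ r <=
    K ^+ r * x `^ (- a + 2 * d%:R * eps).
  have h2 : Num.sqrt (C / (l %/ r).+1%:R) <= Num.sqrt (C * r%:R) * x `^ (- 2^-1).
    rewrite powRN (powR12_sqrt (ltW x0)) -(sqrtrV (ltW x0)) -sqrtrM ?mulr_ge0// ler_wsqrtr//.
    rewrite -mulrA ler_wpM2l// ler_pdivlMr// mulrC ler_pdivrMr// -natrM ler_nat mulnC.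
    exact: ltn_ceil.
  apply: (@le_trans _ _ ((K * x `^ (- eps)) ^+ r)).
    apply: lerXn2r; rewrite ?nnegrE ?mulr_ge0 ?sqrtr_ge0//.
    have -> : K * x `^ (- eps) = 2 * d%:R * y * (Num.sqrt (C * r%:R) * x `^ (- 2^-1)).
      rewrite /K /y -!mulrA; congr (_ * (_ * _)); rewrite mulrCA -gt0_powRD//.
      by congr (_ * _ `^ _); ring.
    apply: ler_pM; [exact: mulr_ge0|exact: sqrtr_ge0| |exact: h2].
    by rewrite natrM mulrA ler_wpM2l.
  rewrite exprMn ler_wpM2l ?exprn_ge0//.
  rewrite -powR_mulrn ?powR_ge0// -powRrM; apply: ler_powR => //.
  rewrite mulNr mulrC; have : 0 <= 2 * d%:R * eps by rewrite !mulr_ge0// ltW.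
  by move: (2 * _ * _) => u u0; lra.
apply: (@le_trans _ _ (Q0 * x `^ (- a + 2 * d%:R * eps))).
  rewrite /Q0 [X in _ <= X]mulrDl; apply: lerD; first by rewrite -mulrA ler_wpM2l.
  by rewrite [X in _ <= X]mulrAC ler_wpM2r ?sqr_ge0// -[X in _ <= X]mulrA ler_wpM2l.
rewrite -[X in _ <= X]mulrA ler_wpM2l//.
rewrite ler_pdivlMr// -/x -{2}[x](powRr1 (ltW x0)) -gt0_powRD//.
apply: (@le_trans _ _ (x `^ (b + 2 * d%:R * eps))).
  by apply: ler_powR => //; move: hb; rewrite aE; move: (2 * _ * _) => u; lra.
apply: (@le_trans _ _ (N%:R `^ (b + 2 * d%:R * eps))).
  apply: ge0_ler_powR; rewrite ?nnegrE ?(ltW x0)//.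
  by rewrite addr_ge0// !mulr_ge0// ltW.
apply: ler_powR => //; rewrite lerD2l ler_wpM2r ?ltW//; lra.
Qed.

End ScaleChoice.

Section CorrelationDecay.
Context (R : realType).

Lemma word_correlation_le (V : finType) (p : V -> R) (d N m n : nat) (step : V -> lattice d)
    (F : lattice d -> R) (M : R) :
  (forall v, 0 <= p v) -> \sum_v p v <= 1 -> (forall x, `|F x| <= M) ->
  `|\sum_(w : {ffun 'I_N -> V}) word_weight p w *
      (F (word_walk step w m) * F (word_walk step w n))| <= M ^+ 2.
Proof.
move=> p0 p1 FM; apply: le_trans (ler_norm_sum _ _ _) _.
apply: (@le_trans _ _ (\sum_(w : {ffun 'I_N -> V}) word_weight p w * M ^+ 2)).
  apply: ler_sum => w _; rewrite normrM (ger0_norm (word_weight_ge0 p0 w)).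
  by rewrite ler_wpM2l ?word_weight_ge0// normrM expr2 ler_pM.
by rewrite -mulr_suml ler_piMl ?sqr_ge0// sum_word_weight.
Qed.

(** For [l + 1] up to [N ^ (b + 6 eps)] the trivial bound [M ^ 2] is good enough. Beyond it, cube
    averages at the scale of [l] are small, and the walk stays in the region where their bound is
    valid. The exponent [b] stands for [2 rho - 1]. *)
Lemma word_correlation_decay (d0 : measure_display) (Omega : measurableType d0)
  (P : probability Omega R) (d : nat) (X : nat -> {RV P >-> lattice d})
  (hid : identically_distributed X)
  (hnd : nondegenerate_walk X) (hap : aperiodic_walk X)
  (F : lattice d -> R) (M beta eps gamma kappa b : R) :
  (forall x, `|F x| <= M) -> averages_near beta gamma F 0 ->
  0 <= beta -> beta < 1 -> 0 < eps -> eps <= 12^-1 -> 0 < gamma -> 0 <= b ->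
  1 + d%:R * (beta - 1) <= b -> kappa <= b + 6 * eps ->
  1 + 2 * eps <= kappa * (2^-1 - eps) * gamma ->
  exists (Q : R) (N0 B0 : nat), 0 <= Q /\ forall N B : nat, (N0 <= N)%N -> (B0 <= B)%N ->
    B%:R <= N%:R `^ eps -> forall m k l, (l <= m)%N -> (l <= k)%N -> (m + k <= N)%N ->
    `|\sum_(w : {ffun 'I_N -> box_index d B}) word_weight (step_prob X \o @box_point d B) w *
       (F (word_walk (@box_point d B) w m) * F (word_walk (@box_point d B) w (m + k)))|
    <= Q * N%:R `^ (b + (6 + 2 * d%:R) * eps) / l.+1%:R.
Proof.
move=> FM hF beta0 beta1 eps0 eps12 gamma0 b0 hb hkappa hgamma.
have [C [B0 [C0 hC]]] := smoothing_words hid hnd hap.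
have [CF CF0 hCF] := cube_average_bound hF.
have [r [r0 hr]] : exists r : nat, (0 < r)%N /\ d%:R <= r%:R * eps.
  exists (Num.truncn (d%:R / eps)).+1; split=> //; rewrite -ler_pdivrMr//.
  by have /andP[_ /ltW] := truncn_itv (divr_ge0 (ler0n R d) (ltW eps0)).
have [Q0 [N0 [Q00 hQ]]] := scale_choice M beta0 beta1 eps0 eps12 gamma0 b0 hb hkappa hgamma
  C0 CF0 r0 hr.
exists (Q0 + M ^+ 2), N0.+1, B0; split; first by rewrite addr_ge0// sqr_ge0.
move=> N B NN0 BB0 BN m k l lm lk mkN.
have N1 : 1 <= N%:R :> R by rewrite ler1n (leq_trans _ NN0).
have p0 v : 0 <= (step_prob X \o @box_point d B) v by exact: step_prob_ge0.
have p1 := sum_box_prob_le1 hid B.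
have Npow u : 0 <= N%:R `^ u :> R by exact: powR_ge0.
have [lN|Nl] := leP l.+1%:R (N%:R `^ (b + 6 * eps)).
  apply: le_trans (word_correlation_le _ _ _ _ p0 p1 FM) _.
  rewrite ler_pdivlMr//; apply: ler_pM; rewrite ?sqr_ge0// ?lerDr//.
  apply: le_trans lN _; apply: ler_powR => //; rewrite lerD2l ler_wpM2r ?(ltW eps0)//.
  by rewrite lerDl mulr_ge0.
have l2N : (2 * l <= N)%N by move: lm lk mkN; clear; lia.
have [n [l' [n0 rl hs hle]]] := hQ N B l (ltnW NN0) BN l2N Nl.
have := correlation_bound p0 p1 (hC B BB0) (F := F) (M := M)
  (delta := CF * n%:R `^ (d%:R * (beta - 1))) (B := B) (N := N) (m := m) (k := k) (l := l')
  (r := r) (n := n) (@sup_norm_box_point d B) FM.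
move=> /(_ _ _ _ _ mkN) h; apply: le_trans (h _ _ _ _) _.
- by rewrite mulr_ge0// powR_ge0.
- by move=> x hx; apply: hCF => //; exact: hs.
- exact: leq_trans lm.
- exact: leq_trans lk.
apply: le_trans hle _; rewrite ler_wpM2r ?invr_ge0// ler_wpM2r// lerDl sqr_ge0//.
Qed.

End CorrelationDecay.

(** * Almost sure bounds *)

Section ExponentChoice.
Context (R : realType) (d : nat).
Implicit Types (beta gamma : R) (F : lattice d -> R).

(** In fact [2 rho - 1] is the larger of 0 and [1 + d (beta - 1)]. *)
Lemma rho_ge (beta : R) : (0 < d)%N ->
  2^-1 <= rho d beta /\ 1 + d%:R * (beta - 1) <= 2 * rho d beta - 1.
Proof.
move=> d0; have dR : 0 < d%:R :> R by rewrite ltr0n.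
rewrite /rho; case: ifPn => [|].
  rewrite ler_pdivlMr// => h; split; first by rewrite div1r.
  by rewrite mulrBr mulr1 mulrC; lra.
rewrite -ltNge ltr_pdivrMr// => h.
have h' : d%:R - 1 < d%:R * beta by rewrite mulrC.
have -> : d%:R / 2 * (beta - 1) + 1 = (d%:R * beta - d%:R) / 2 + 1 :> R by ring.
have -> : d%:R * (beta - 1) = d%:R * beta - d%:R :> R by ring.
by move: (d%:R * beta) h' => t h'; split; lra.
Qed.

Lemma class_G_average0 beta gamma F : (0 < d)%N -> beta < 1 -> 0 < gamma ->
  class_G beta gamma F -> global_average beta F 0 -> averages_near beta gamma F 0.
Proof.
move=> d0 b1 g0 [_ [m hm]] h0.
by rewrite -(global_average_unique d0 b1 (ex_intro2 _ _ gamma g0 hm) h0).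
Qed.

(** If all [gamma] are allowed, [kappa = eps] and a large [gamma] do. For [d = 1] and
    [gamma = 2 / beta], the lag exceeds [N ^ (beta + 6 eps)], so a cube whose side [n] is close to
    the square root of the lag has [n ^ gamma] beyond [N]. This is the origin of the critical
    exponent, and [6 eps] pays for the losses. *)
Lemma class_parameters beta F (eps : R) :
  0 <= beta -> beta < 1 ->
  (d = 1%N /\ class_G_critical beta F) \/ ((2 <= d)%N /\ class_G_infty beta F) ->
  global_average beta F 0 -> 0 < eps -> eps <= 12^-1 ->
  exists M gamma kappa : R, [/\ forall x, `|F x| <= M, averages_near beta gamma F 0,
    0 < gamma, kappa <= 2 * rho d beta - 1 + 6 * eps &
    1 + 2 * eps <= kappa * (2^-1 - eps) * gamma].
Proof.
move=> beta0 beta1 hF hF0 eps0 eps12.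
have d0 : (0 < d)%N by case: hF => [[d1 _]|[d2 _]]; [rewrite d1|exact: ltnW].
have [rho1 rho2] := rho_ge beta d0.
have e2 : 0 < 2^-1 - eps by lra.
have [hinf|[d1 [betap hG]]] : class_G_infty beta F \/
    (d = 1%N /\ (0 < beta /\ class_G beta (2 / beta) F)).
  case: hF => [[d1]|[_ ?]]; last by left.
  rewrite /class_G_critical; case: eqVneq => [_ ?|bn0 hG]; first by left.
  by right; split=> //; split=> //; rewrite lt_neqAle eq_sym bn0.
  pose gamma := (1 + 2 * eps) / (eps * (2^-1 - eps)).
  have g0 : 0 < gamma by rewrite divr_gt0 ?mulr_gt0// addr_gt0// mulr_gt0.
  have hG := hinf gamma g0; have [[M FM] _] := hG.
  exists M, gamma, eps; split=> //.
  - exact: class_G_average0.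
  - by lra.
  - by rewrite /gamma [X in _ <= X]mulrC divfK// gt_eqF// mulr_gt0.
have g0 : 0 < 2 / beta by rewrite divr_gt0.
have [[M FM] _] := hG.
exists M, (2 / beta), (beta + 6 * eps); split=> //.
- exact: class_G_average0.
- have dR : d%:R = 1 :> R by rewrite d1.
  by move: rho2; rewrite dR mul1r; lra.
rewrite mulrA ler_pdivlMr//.
have h : eps * beta <= eps by rewrite ler_piMr// ltW.
have h2 : eps * eps <= 12^-1 * eps by rewrite ler_wpM2r// ltW.
have -> : (beta + 6 * eps) * (2^-1 - eps) * 2 =
    beta + 6 * eps - 2 * (eps * beta) - 12 * (eps * eps).
  by field.
have -> : (1 + 2 * eps) * beta = beta + 2 * (eps * beta) by ring.
by move: (eps * beta) (eps * eps) h h2 => u v h h2; lra.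
Qed.

End ExponentChoice.

(** * Summability over the dyadic scales *)

Section Summability.
Context (R : realType).

(** [s ^ j] is the smallest of the [j + 1] terms of a geometric sum, which is at most
    [1 / (1 - s)]. *)
Lemma geometric_poly_bound (s : R) (j : nat) : 0 <= s -> s < 1 -> (1 - s) * (j.+1%:R * s ^+ j) <= 1.
Proof.
move=> s0 s1; have s1' : 0 <= 1 - s by rewrite subr_ge0 ltW.
apply: (@le_trans _ _ ((1 - s) * \sum_(i < j.+1) s ^+ i)).
  rewrite ler_wpM2l//.
  have -> : j.+1%:R * s ^+ j = \sum_(i < j.+1) s ^+ j by rewrite sumr_const card_ord mulr_natl.
  by apply: ler_sum => i _; apply: ler_wiXn2l => //; [exact: ltW|rewrite -ltnS].
by rewrite -opprB mulNr -subrX1 opprB gerBl exprn_ge0.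
Qed.

Lemma nneseries_geometric_lty (u : nat -> \bar R) (C s : R) :
  0 <= C -> 0 <= s -> s < 1 -> (forall j, (0 <= u j)%E) -> (forall j, (u j <= (C * s ^+ j)%:E)%E) ->
  (\sum_(j <oo) u j < +oo)%E.
Proof.
move=> C0 s0 s1 u0 hu.
apply: (@le_lt_trans _ _ (C / (1 - s))%:E); last by rewrite ltry.
apply: lime_le; first by apply: is_cvg_nneseries.
apply: nearW => n; apply: (@le_trans _ _ (\sum_(0 <= j < n) (C * s ^+ j)%:E)%E).
  by apply: lee_sum.
rewrite sumEFin lee_fin -mulr_sumr ler_wpM2l//.
rewrite -[X in _ <= X]mul1r ler_pdivlMr ?subr_gt0// big_mkord mulrC.
by rewrite -opprB mulNr -subrX1 opprB gerBl exprn_ge0.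
Qed.

End Summability.

Section AlmostSure.
Context (R : realType) (d0 : measure_display) (Omega : measurableType d0).
Context (P : probability Omega R) (d : nat) (X : nat -> {RV P >-> lattice d}).

Lemma word_functional_eq (V : finType) (step : V -> lattice d) (F : lattice d -> R)
    N (w : {ffun 'I_N -> V}) o (n : nat) : (n <= N)%N ->
  (forall i : 'I_N, X i o = step (w i)) ->
  additive_functional X F n o = word_functional step F w n.
Proof.
move=> nN hw; apply: eq_big_nat => i /andP[_ iN]; congr F.
rewrite /walk /word_walk (big_ord_widen N (fun j => X j o)); last by rewrite -ltnS (leq_trans iN).
by apply: eq_bigr => j _.
Qed.

Context (hind : mutually_independent X) (hid : identically_distributed X)
  (hnd : nondegenerate_walk X) (hap : aperiodic_walk X) (hmom : all_moments_finite X).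
Context (beta : R) (beta0 : 0 <= beta) (beta1 : beta < 1) (F : lattice d -> R).
Context (hF : (d = 1%N /\ class_G_critical beta F) \/ ((2 <= d)%N /\ class_G_infty beta F)).
Context (hF0 : global_average beta F 0).

(** With [N = 2 ^ j], [A j] covers the event that the bound fails at some time up to [N] or that a
    step leaves the box of radius about [N ^ eps]. Up to [(j + 1) ^ 3], the maximal inequality gives
    [N * N ^ (2 rho - 1 + e)] over [N ^ (2 rho + 2 e)], that is [N ^ (- e)]. *)
Lemma dyadic_exceptional_sets (e : R) : 0 < e -> e <= 1 ->
  exists (A : nat -> set Omega) (j0 : nat) (K : R),
  [/\ forall j, measurable (A j), 0 <= K,
      forall j, (P (A j) <= (K * (j.+1%:R ^+ 3 * (2 ^ j)%:R `^ (- e)))%:E)%E &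
      forall j o, (j0 <= j)%N -> ~ A j o -> forall n, (n <= 2 ^ j)%N ->
        `|additive_functional X F n o| <= (2 ^ j)%:R `^ (rho d beta + e)].
Proof.
move=> e0 e1.
(* All losses, [(6 + 2 d) eps] in total, have to stay below [e]. *)
pose eps := Num.min 12^-1 (e / (6 + 2 * d%:R)).
have c0 : 0 < 6 + 2 * d%:R :> R by rewrite ltr_wpDr// mulr_ge0.
have eps0 : 0 < eps by rewrite lt_min invr_gt0 ltr0n/= divr_gt0.
have eps12 : eps <= 12^-1 by rewrite ge_min lexx.
have epse : (6 + 2 * d%:R) * eps <= e by rewrite mulrC -ler_pdivlMr// ge_min lexx orbT.
have [M [gamma [kappa [FM hav g0 hk hg]]]] := class_parameters beta0 beta1 hF hF0 eps0 eps12.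
have dpos : (0 < d)%N by case: hF => [[d1 _]|[d2 _]]; [rewrite d1|exact: ltnW].
have [rho1 rho2] := rho_ge beta dpos.
have b0 : 0 <= 2 * rho d beta - 1 by lra.
have [Q [N0 [B0 [Q0 hQ]]]] := word_correlation_decay hid hnd hap FM hav beta0 beta1
  eps0 eps12 g0 b0 rho2 hk hg.
(* With [q eps >= 2], the union bound over [N] steps gives at most [N * N ^ (- 2)], hence at most
   [N ^ (- e)] since [e <= 1]. *)
pose q := (Num.truncn (2 / eps)).+1.
have qeps : 2 <= eps * q%:R.
  rewrite mulrC -ler_pdivrMr//.
  by have /andP[_ /ltW] := truncn_itv (divr_ge0 (ler0n R 2) (ltW eps0)).
have [K [K0 hK]] := word_cover hind hid hmom q.
pose B j := Num.truncn ((2 ^ j)%:R `^ eps : R).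
pose lam j : R := (2 ^ j)%:R `^ (rho d beta + e).
have hA j := hK (2 ^ j)%N (B j) (fun w =>
  [exists n : 'I_(2 ^ j).+1, lam j < `|word_functional (@box_point d (B j)) F w n|]).
have /choice[A1 hA1] := hA.
(* From [j0] on, [2 ^ j >= N0] and [B j >= B0]; before, [A j] is set to be empty so that its
   probability bound holds for every [j]. *)
pose j0 := maxn N0 (Num.truncn (B0%:R `^ eps^-1 : R)).+1.
pose A j := if (j0 <= j)%N then A1 j else set0.
have j2 j : (j <= 2 ^ j)%N by rewrite ltnW// ltn_expl.
have N1 j : 1 <= (2 ^ j)%:R :> R by rewrite ler1n expn_gt0.
have Npos j : 0 < (2 ^ j)%:R :> R by rewrite (lt_le_trans ltr01).
exists A, j0, (5 * Q + K); split.
- by move=> j; rewrite /A; case: ifP => // _; have [] := hA1 j.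
- by rewrite addr_ge0// mulr_ge0.
- move=> j; rewrite /A; case: ifPn => [j0j|_]; last first.
    by rewrite measure0 lee_fin !mulr_ge0 ?powR_ge0 ?exprn_ge0 ?addr_ge0// mulr_ge0.
  have [_ + _] := hA1 j; move/le_trans; apply; rewrite lee_fin.
  have NN : (N0 <= 2 ^ j)%N by rewrite (leq_trans _ (j2 j))// (leq_trans _ j0j)// leq_maxl.
  have [BN BN'] : (B j)%:R <= (2 ^ j)%:R `^ eps /\ (2 ^ j)%:R `^ eps <= (B j).+1%:R :> R.
    by have /andP[h1 h2] := truncn_itv (powR_ge0 ((2 ^ j)%:R : R) eps); split=> //; exact: ltW.
  have BB : (B0 <= B j)%N.
    rewrite truncn_ge_nat ?powR_ge0//.
    have -> : B0%:R = (B0%:R `^ eps^-1) `^ eps :> R by rewrite -powRrM mulVf ?gt_eqF// powRr1.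
    apply: ge0_ler_powR; rewrite ?nnegrE ?powR_ge0 ?(ltW eps0)//.
    have /andP[_ /ltW h] := truncn_itv (powR_ge0 (B0%:R : R) eps^-1).
    apply: le_trans h _; rewrite ler_nat; apply: leq_trans (j2 j).
    by apply: leq_trans j0j; rewrite leq_maxr.
  have lam0 : 0 < lam j by exact: powR_gt0.
  rewrite [(5 * Q + K) * _]mulrDl; apply: lerD.
    have p0 v : 0 <= (step_prob X \o @box_point d (B j)) v by exact: step_prob_ge0.
    apply: le_trans.
      apply: (word_maximal_inequality p0 (step := @box_point d (B j)) (F := F)
        (Q := Q * (2 ^ j)%:R `^ (2 * rho d beta - 1 + (6 + 2 * d%:R) * eps)) lam0).
      by move=> m k l lm lk mk; exact: (hQ _ _ NN BB BN m k l lm lk mk).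
    rewrite ler_pdivrMr ?exprn_gt0//.
    set g := 2 * rho d beta - 1 + _.
    have -> : 5 * j.+1%:R ^+ 3 * (2 ^ j)%:R * (Q * (2 ^ j)%:R `^ g) =
        5 * Q * j.+1%:R ^+ 3 * ((2 ^ j)%:R * (2 ^ j)%:R `^ g) by ring.
    have -> : 5 * Q * (j.+1%:R ^+ 3 * (2 ^ j)%:R `^ (- e)) * lam j ^+ 2 =
        5 * Q * j.+1%:R ^+ 3 * ((2 ^ j)%:R `^ (- e) * lam j ^+ 2) by ring.
    apply: ler_wpM2l; first by rewrite !mulr_ge0 ?exprn_ge0.
    rewrite -{1}[(2 ^ j)%:R](powRr1 (ltW (Npos j))) -gt0_powRD//.
    rewrite /lam expr2 -!gt0_powRD//; apply: ler_powR => //.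
    by rewrite /g; move: epse; move: ((6 + 2 * d%:R) * eps) => u; lra.
  rewrite mulrCA ler_wpM2l//.
  apply: (@le_trans _ _ ((2 ^ j)%:R `^ (- e))); last first.
    by rewrite ler_peMl ?powR_ge0// exprn_ege1// ler1n.
  rewrite ler_pdivrMr ?exprn_gt0//.
  apply: (@le_trans _ _ ((2 ^ j)%:R `^ (- e) * (2 ^ j)%:R `^ (eps * q%:R))).
    rewrite -gt0_powRD// -{1}[(2 ^ j)%:R](powRr1 (ltW (Npos j))); apply: ler_powR => //.
    by move: qeps; move: (eps * q%:R) => u; lra.
  rewrite ler_wpM2l ?powR_ge0// powRrM powR_mulrn ?powR_ge0//.
  by rewrite lerXn2r ?nnegrE ?powR_ge0.
- move=> j o j0j; rewrite /A j0j => nA n nN.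
  have [_ _ /(_ o nA)[w [nbad hw]]] := hA1 j.
  rewrite (word_functional_eq F nN hw); rewrite negb_exists in nbad.
  move/forallP: nbad => /(_ (Ordinal (nN : (n < (2 ^ j).+1)%N))) /=.
  by rewrite -leNgt.
Qed.

(** Borel--Cantelli along the powers of two. *)
Lemma ae_dyadic_bound (e : R) : 0 < e -> e <= 1 ->
  {ae P, forall o, exists j1, forall j, (j1 <= j)%N -> forall n, (n <= 2 ^ j)%N ->
    `|additive_functional X F n o| <= (2 ^ j)%:R `^ (rho d beta + e)}.
Proof.
move=> e0 e1; have [A [j0 [K [mA K0 PA hA]]]] := dyadic_exceptional_sets e0 e1.
(* [(2 ^ j) ^ (- e)] is [s ^ (4 j)]: three factors [s ^ j] absorb [(j + 1) ^ 3], and the fourth is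
   summable. *)
pose s : R := 2 `^ (- e / 4).
have s0 : 0 < s by exact: powR_gt0.
have s1 : s < 1.
  rewrite /s mulNr powRN invf_lt1 ?powR_gt0// -[X in X < _](powRr0 2).
  rewrite /powR gt_eqF// ltr_expR ltr_pM2r ?divr_gt0//.
  by rewrite ln_gt0// ltr1n.
have sE j : (2 ^ j)%:R `^ (- e) = (s ^+ j) ^+ 4.
  rewrite -exprM mulnC exprM -[s ^+ 4]powR_mulrn ?(ltW s0)// -powRrM mulfVK//.
  by rewrite natrX -powR_mulrn// powRAC powR_mulrn ?powR_ge0.
have Asum : (\sum_(j <oo) P (A j) < +oo)%E.
  have C0 : 0 <= K * (1 - s)^-1 ^+ 3.
    by rewrite mulr_ge0// exprn_ge0// invr_ge0 subr_ge0 ltW.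
  apply: (nneseries_geometric_lty C0 (ltW s0) s1) => // j.
  apply: le_trans (PA j) _; rewrite lee_fin -mulrA ler_wpM2l// sE.
  have -> : j.+1%:R ^+ 3 * s ^+ j ^+ 4 = (j.+1%:R * s ^+ j) ^+ 3 * s ^+ j by ring.
  rewrite ler_wpM2r ?exprn_ge0 ?(ltW s0)//.
  rewrite lerXn2r ?nnegrE ?mulr_ge0 ?exprn_ge0 ?invr_ge0 ?subr_ge0 ?(ltW s0) ?(ltW s1)//.
  by rewrite -[X in _ <= X]mulr1 ler_pdivlMl ?subr_gt0// geometric_poly_bound// ltW.
exists (lim_sup_set A); split.
- by apply: bigcapT_measurable => n; apply: bigcup_measurable => k _.
- exact: lim_sup_set_cvg0.
- move=> o /= no; apply: contrapT => nls; apply: no.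
  have [n0 hn0] : exists n, forall j, (n <= j)%N -> ~ A j o.
    apply: contrapT => h; apply: nls => n _; apply: contrapT => hn; apply: h.
    by exists n => j nj Aj; apply: hn; exists j.
  exists (maxn n0 j0) => j; rewrite geq_max => /andP[h1 h2].
  by apply: hA => //; exact: hn0.
Qed.

(** A time [n] with [2 ^ t <= n < 2 ^ (t + 1)] falls under the bound at scale [t + 1], at the cost
    of a factor 2 inside the power. One half of [eps] pays for [1 / (k + 1)], the other for the
    constants. *)
Lemma cvg_of_dyadic_bounds (T : nat -> R) (r : R) : 0 <= r ->
  (forall k : nat, exists j1, forall j, (j1 <= j)%N -> forall n, (n <= 2 ^ j)%N ->
    `|T n| <= (2 ^ j)%:R `^ (r + k.+1%:R^-1)) ->
  forall eps : R, 0 < eps -> (fun N : nat => T N / N%:R `^ (r + eps)) @ \oo --> (0 : R).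
Proof.
move=> r0 hT eps eps0.
pose k := Num.truncn (2 / eps).
have ke : k.+1%:R^-1 <= eps / 2.
  rewrite -[eps / 2]invrK lef_pV2 ?posrE ?invr_gt0 ?divr_gt0// invf_div.
  by have /andP[_ /ltW] := truncn_itv (divr_ge0 (ler0n R 2) (ltW eps0)).
have [j1 hj1] := hT k; set e := k.+1%:R^-1 in ke hj1.
have e0 : 0 < e by rewrite invr_gt0.
have eps2 : 0 < eps / 2 by exact: divr_gt0.
apply/cvgrPdist_le => eta eta0.
(* [c] is what [n ^ (eps / 2)] has to reach for the quotient to be at most [eta]. *)
pose c : R := 2 `^ (r + e) / eta.
exists (maxn (2 ^ j1) (Num.truncn (c `^ (eps / 2)^-1)).+1) => // n /=.
rewrite geq_max => /andP[n1 n2].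
have n0 : (0 < n)%N by rewrite (leq_trans _ n1)// expn_gt0.
have nR : 0 < n%:R :> R by rewrite ltr0n.
have nR1 : 1 <= n%:R :> R by rewrite ler1n.
have c0 : 0 < c by rewrite divr_gt0// powR_gt0.
rewrite sub0r normrN normrM (ger0_norm (_ : 0 <= (_ `^ _)^-1)) ?invr_ge0 ?powR_ge0//.
rewrite ler_pdivrMr ?powR_gt0//.
have /andP[t1 t2] := trunc_log_bounds (isT : (1 < 2)%N) n0.
set t := trunc_log 2 n in t1 t2.
have tj : (j1 <= t.+1)%N.
  by rewrite -(leq_exp2l _ _ (isT : (1 < 2)%N)) (leq_trans n1)// ltnW.
apply: le_trans (hj1 _ tj n (ltnW t2)) _.
apply: (@le_trans _ _ ((2 * n%:R) `^ (r + e))).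
  apply: ge0_ler_powR; rewrite ?nnegrE ?mulr_ge0 ?addr_ge0 ?(ltW e0)//.
  by rewrite -natrM ler_nat expnS leq_mul2l.
rewrite powRM//.
have -> : 2 `^ (r + e) = eta * c by rewrite /c mulrC divfK// gt_eqF.
rewrite -mulrA ler_wpM2l ?(ltW eta0)//.
apply: (@le_trans _ _ (n%:R `^ (eps / 2) * n%:R `^ (r + e))).
  rewrite ler_wpM2r ?powR_ge0//.
  have -> : c = (c `^ (eps / 2)^-1) `^ (eps / 2).
    by rewrite -powRrM mulVf ?gt_eqF// powRr1// ltW.
  apply: ge0_ler_powR; rewrite ?nnegrE ?powR_ge0 ?(ltW eps2)//.
  have /andP[_ /ltW h] := truncn_itv (powR_ge0 c (eps / 2)^-1).
  by apply: le_trans h _; rewrite ler_nat.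
rewrite -gt0_powRD//; apply: ler_powR => //; lra.
Qed.

End AlmostSure.

Theorem corollary1p5 (R : realType) (d0 : measure_display)
  (Omega : measurableType d0) (P : probability Omega R)
  (d : nat) (X : nat -> {RV P >-> lattice d})
  (hind : mutually_independent X) (hid : identically_distributed X)
  (hnd : nondegenerate_walk X) (hap : aperiodic_walk X)
  (hcent : centered_step X) (hmom : all_moments_finite X)
  (beta : R) (hbeta : 0 <= beta < 1) (F : lattice d -> R)
  (hF : (d = 1%N /\ class_G_critical beta F) \/ ((2 <= d)%N /\ class_G_infty beta F))
  (hF0 : global_average beta F 0) :
  {ae P, forall w, forall eps : R, 0 < eps ->
    (fun N : nat => additive_functional X F N w / N%:R `^ (rho d beta + eps))
      @ \oo --> (0 : R)}.
Proof.
have /andP[beta0 beta1] := hbeta.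
have dpos : (0 < d)%N by case: hF => [[d1 _]|[d2 _]]; [rewrite d1|exact: ltnW].
have [rho1 _] := rho_ge beta dpos.
have rho0 : 0 <= rho d beta by apply: le_trans rho1; rewrite invr_ge0.
have k0 (k : nat) : 0 < k.+1%:R^-1 :> R by rewrite invr_gt0.
have k1 (k : nat) : k.+1%:R^-1 <= 1 :> R by rewrite invf_le1// ler1n.
have H k := ae_dyadic_bound hind hid hnd hap hmom beta0 beta1 hF hF0 (k0 k) (k1 k).
(* Countably many null sets, one for each exponent [1 / (k + 1)], are discarded together, so that
   almost every path works for all [eps] at once. *)
have := ae_foralln H; apply: filterS => w hw eps eps0.
exact: (cvg_of_dyadic_bounds rho0 hw).
Qed.
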